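(* Let $(\mathcal{A},m)$ be a nonempty multiarrangement in an $\ell$-dimensional vector space $V$ over a field $\mathbb{K}$ with $\ell\ge 2$, let $H_0\in\mathcal{A}$, and let $(\mathcal{A},m),(\mathcal{A}',m'),(\mathcal{A}'',m^* )$ be the triple with respect to $H_0$. Assume that $(\mathcal{A}',m')$ and $(\mathcal{A}'',m^* )$ are both free and $\exp(\mathcal{A}'',m^* )\subset\exp(\mathcal{A}',m')$ (inclusion of multisets). Then $(\mathcal{A},m)$ is also free.
   Context: Let $\mathbb{K}$ be a field, $V$ an $\ell$-dimensional $\mathbb{K}$-vector space, $S=\mathrm{Sym}(V^* )\cong\mathbb{K}[x_1,\ldots,x_\ell]$, and $\mathrm{Der}_{\mathbb{K}}(S)=\bigoplus_i S\,\partial_{x_i}$ the $S$-module of $\mathbb{K}$-linear derivations of $S$. An arrangement is a finite set $\mathcal{A}$ of hyperplanes of $V$, all containing the origin; for each $H\in\mathcal{A}$ fix a linear form $\alpha_H$ with $H=\ker\alpha_H$. A multiarrangement $(\mathcal{A},m)$ is an arrangement with a multiplicity $m:\mathcal{A}\to\mathbb{Z}_{>0}$. Define $D(\mathcal{A},m)=\{\theta\in\mathrm{Der}_{\mathbb{K}}(S)\mid\theta(\alpha_H)\in\alpha_H^{m(H)}S\text{ for all }H\in\mathcal{A}\}$; $(\mathcal{A},m)$ is free if $D(\mathcal{A},m)$ is a free $S$-module. A nonzero derivation $\theta=\sum f_i\partial_{x_i}$ is homogeneous of degree $p$ if each $f_i$ is zero or homogeneous of degree $p$. If $(\mathcal{A},m)$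 is free, $\exp(\mathcal{A},m)$ is the multiset of degrees of a homogeneous basis of $D(\mathcal{A},m)$ (independent of the basis). Triple with respect to $H_0\in\mathcal{A}$, with $\alpha_0=\alpha_{H_0}$: Deletion $(\mathcal{A}',m')$: if $m(H_0)=1$, then $\mathcal{A}'=\mathcal{A}\setminus\{H_0\}$ and $m'=m|_{\mathcal{A}'}$; if $m(H_0)\ge2$, then $\mathcal{A}'=\mathcal{A}$, $m'(H)=m(H)$ for $H\ne H_0$, and $m'(H_0)=m(H_0)-1$. Restriction $(\mathcal{A}'',m^* )$: $\mathcal{A}''=\{H_0\cap K\mid K\in\mathcal{A}\setminus\{H_0\}\}$, an arrangement in the vector space $H_0$, and $m^*$ is the Euler multiplicity: for $X\in\mathcal{A}''$ put $\mathcal{A}_X=\{H\in\mathcal{A}\mid X\subset H\}$, $m_X=m|_{\mathcal{A}_X}$, and choose coordinates so that $X=\{x_1=x_2=0\}$; then $D(\mathcal{A}_X,m_X)$ has a homogeneous basis $\theta_X,\psi_X,\partial_{x_3},\ldots,\partial_{x_\ell}$ with $\theta_X\notin\alpha_0\mathrm{Der}_{\mathbb{K}}(S)$ and $\psi_X\in\alpha_0\mathrm{Der}_{\mathbb{K}}(S)$, and $m^*(X):=\deg\theta_X$. *)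

(* Defs.v *)
From mathcomp Require Import all_boot all_order all_algebra.
From mathcomp Require Import finmap multiset mpoly.
From Stdlib Require Import ClassicalEpsilon.

Set Implicit Arguments.
Unset Strict Implicit.
Unset Printing Implicit Defensive.

Import GRing.Theory.
Local Open Scope ring_scope.

Section Derivations.
Variables (K : fieldType) (V : vectType K).
Implicit Types (U X H : {vspace V}) (a : 'Hom(V, K^o)) (v : V).

(* Sym(V^* ) is identified with K[x_1, ..., x_l], where x_1, ..., x_l are the
   coordinates of V dual to the basis [vbasis fullv]. *)
Local Notation symalg := {mpoly K[\dim (fullv : {vspace V})]}.

(* The row vector (f_1, ..., f_l) stands for the derivation
   f_1 d/dx_1 + ... + f_l d/dx_l. *)
Local Notation der := 'rV[symalg]_(\dim (fullv : {vspace V})).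

Definition form_poly a : symalg :=
  \sum_(i < \dim (fullv : {vspace V})) (a (vbasis fullv)`_i)%:MP * 'X_i.

Definition der_apply (theta : der) (f : symalg) : symalg :=
  \sum_i theta 0 i * f^`M(i).

(* The constant derivation along v; if e is a basis of V with dual coordinates
   y, then [der_along e`_i] is d/dy_i. *)
Definition der_along v : der :=
  \row_i (coord (vbasis fullv) i v)%:MP.

Definition der_homog (p : nat) (theta : der) : bool :=
  (theta != 0) && [forall i, theta 0 i \is p.-homog].

Definition is_hyperplane H : bool := (\dim H).+1 == \dim (fullv : {vspace V}).

(* An arbitrary but fixed linear form with kernel H (junk unless H is a
   hyperplane). *)
Definition alpha H : 'Hom(V, K^o) :=
  epsilon (inhabits 0) (fun a => lker a = H).

Definition is_multiarrangement (A : {fset {vspace V}}) (m : {vspace V} -> nat) :=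
  forall H, H \in A -> is_hyperplane H /\ (0 < m H)%N.

(* D(A, m); only the values of m on A matter. *)
Definition logder (A : {fset {vspace V}}) (m : {vspace V} -> nat)
    (theta : der) : Prop :=
  forall H, H \in A ->
    exists g : symalg,
      der_apply theta (form_poly (alpha H)) = form_poly (alpha H) ^+ m H * g.

Definition is_module_basis (D : der -> Prop) (b : seq der) : Prop :=
  [/\ forall i : 'I_(size b), D b`_i,
      forall theta, D theta ->
        exists f : 'I_(size b) -> symalg, theta = \sum_i f i *: b`_i
    & forall f : 'I_(size b) -> symalg,
        \sum_i f i *: b`_i = 0 -> forall i, f i = 0].

(* Finite bases suffice: a submodule of S^l has no independent family of more
   than l elements. *)
Definition is_free A m : Prop :=
  exists b : seq der, is_module_basis (logder A m) b.

Definition is_exp A m (E : {mset nat}%mset) : Prop :=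
  exists (b : seq der) (d : seq nat),
    [/\ is_module_basis (logder A m) b,
        all2 der_homog d b
      & E = seq_mset d].

(* exp(A, m); junk unless (A, m) is free. *)
Definition exponents A m : {mset nat}%mset :=
  epsilon (inhabits mset0) (is_exp A m).

Definition localization (A : {fset {vspace V}}) X : {fset {vspace V}} :=
  [fset H in A | (X <= H)%VS]%fset.

(* theta \in alpha_H Der(S) *)
Definition in_alpha_der H (theta : der) : Prop :=
  exists eta : der, theta = form_poly (alpha H) *: eta.

(* d = deg theta_X.  Coordinates y_1, ..., y_l with X = {y_1 = y_2 = 0} are
   given by the dual basis e of V: the condition on X says that X is spanned by
   e_3, ..., e_l. *)
Definition is_euler_mult (A : {fset {vspace V}}) (m : {vspace V} -> nat)
    H0 X (d : nat) : Prop :=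
  exists (e : seq V) (theta psi : der) (q : nat),
    [/\ basis_of fullv e /\ X = <<drop 2 e>>%VS,
        is_module_basis (logder (localization A X) m)
          [:: theta, psi & [seq der_along v | v <- drop 2 e]],
        der_homog d theta /\ der_homog q psi,
        ~ in_alpha_der H0 theta
      & in_alpha_der H0 psi].

Definition euler_mult A m H0 X : nat :=
  epsilon (inhabits 0%N) (is_euler_mult A m H0 X).

End Derivations.

Section Triple.
Variables (K : fieldType) (V : vectType K).
Variables (A : {fset {vspace V}}) (m : {vspace V} -> nat) (H0 : {vspace V}).

Definition deletion : {fset {vspace V}} :=
  if m H0 == 1%N then (A `\ H0)%fset else A.

Definition deletion_mult (H : {vspace V}) : nat :=
  if H == H0 then (m H0).-1 else m H.

(* H0 as a vector space is [subvs_of H0]; the intersection of H0 and U, viewed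
   inside it, is the preimage of U under the inclusion. *)
Definition trace_on (U : {vspace V}) : {vspace subvs_of H0} :=
  (linfun (vsval : subvs_of H0 -> V) @^-1: U)%VS.

Definition from_trace (X : {vspace subvs_of H0}) : {vspace V} :=
  (linfun (vsval : subvs_of H0 -> V) @: X)%VS.

Definition restriction : {fset {vspace subvs_of H0}} :=
  [fset trace_on U | U in (A `\ H0)%fset]%fset.

Definition restriction_mult (X : {vspace subvs_of H0}) : nat :=
  euler_mult A m H0 (from_trace X).

End Triple.

(* Main.v *)
Require Import Defs.
From HB Require Import structures.
From mathcomp Require Import all_boot all_order all_algebra.
From mathcomp Require Import finmap multiset mpoly.
From mathcomp Require Import perm ring zify.
From Stdlib Require Import ClassicalEpsilon.

(* Write alpha for the equation of H_0 and S'' for the coordinate ring of H_0.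
   By Saito's criterion the exponents of (A', m') and (A'', m^* ) add up to |m'|
   and |m^*|, so exp(A', m') is exp(A'', m^* ) together with r = |m'| - |m^*|.
   If all elements of degree at most r of a homogeneous basis of D(A', m') were
   in D(A, m), their restrictions to H_0 would lie in D(A'', m^* ) and be more
   numerous than the basis elements of degree at most r there; a relation
   between them over S'' lifts to an element alpha eta of D(A, m), and eta in
   D(A', m') contradicts independence.  So some basis element theta of degree
   at most r is not in D(A, m).

   For every eta in D(A', m'), eta(alpha) / alpha^(m(H_0) - 1) is modulo alpha a
   multiple of one polynomial B on H_0, whose degree is the one expected of
   theta.  So theta attains c B with c a nonzero constant, multiples of theta
   correct the other basis elements into D(A, m), and alpha theta completes a
   basis.  The factor of B at X comes from the rank two multiarrangement
   (A_X, m_X), whose basis is built by raising the multiplicities one by one. *)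

Set Implicit Arguments.
Unset Strict Implicit.
Unset Printing Implicit Defensive.

Import GRing.Theory.
Local Open Scope ring_scope.

(** * Divisibility and linear forms in polynomial rings *)

(** The degree of B comes from rank two. At X the element psi_X can be taken as alpha_0 u with u in
    D for the multiplicity lowered at H_0, of degree |m_X| - m^*(X) - 1. Removing alpha_0^(m(H_0) -
    1) from u(alpha_0) leaves on H_0 a power of the equation of X, of degree |m_X| - m^*(X) -
    m(H_0). The traces partition the hyperplanes other than H_0, so summing over X gives deg B = |m|
    - |m^*| - m(H_0) = r - (m(H_0) - 1). A basis element of degree at most r outside D(A, m) leaves
    a nonzero multiple of B of at most this degree, hence a constant multiple.

    Exponents and Euler multiplicities are values of [epsilon], which say nothing until existence is
    proved: a free D(A, m) must have a homogeneous basis, a rank two basis of the prescribed shape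
    must exist, and the degree of its first element must not depend on the choice. *)

Section Divisibility.
Variable R : idomainType.
Implicit Types f g h : R.

Definition divides f g := exists h, g = f * h.

Lemma divides_refl f : divides f f.
Proof. by exists 1; rewrite mulr1. Qed.

Lemma divides0 f : divides f 0.
Proof. by exists 0; rewrite mulr0. Qed.

Lemma divides_trans g f h : divides f g -> divides g h -> divides f h.
Proof. by move=> [u ->] [v ->]; exists (u * v); rewrite mulrA. Qed.

Lemma divides_mull h f g : divides f g -> divides f (h * g).
Proof. by move=> [u ->]; exists (h * u); rewrite mulrCA. Qed.

Lemma divides_mulr h f g : divides f g -> divides f (g * h).
Proof. by rewrite mulrC; apply: divides_mull. Qed.

Lemma dividesD f g h : divides f g -> divides f h -> divides f (g + h).
Proof. by move=> [u ->] [v ->]; exists (u + v); rewrite mulrDr. Qed.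

Lemma dividesN f g : divides f g -> divides f (- g).
Proof. by move=> [u ->]; exists (- u); rewrite mulrN. Qed.

Lemma dividesB f g h : divides f g -> divides f h -> divides f (g - h).
Proof. by move=> fg fh; apply/dividesD/dividesN. Qed.

Lemma divides_sum (I : Type) (r : seq I) (P : pred I) (F : I -> R) f :
  (forall i, P i -> divides f (F i)) -> divides f (\sum_(i <- r | P i) F i).
Proof.
move=> fF; apply: (big_ind (divides f)) => //; first exact: divides0.
by move=> x y; apply: dividesD.
Qed.

Lemma dividesM f1 f2 g1 g2 :
  divides f1 g1 -> divides f2 g2 -> divides (f1 * f2) (g1 * g2).
Proof. by move=> [u ->] [v ->]; exists (u * v); rewrite mulrACA. Qed.

Lemma divides_exp_leq f k l : (k <= l)%N -> divides (f ^+ k) (f ^+ l).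
Proof. by move=> kl; exists (f ^+ (l - k)); rewrite -exprD subnKC. Qed.

Lemma divides_cancel f g h : h != 0 -> divides (h * f) (h * g) -> divides f g.
Proof. by move=> h0 [u]; rewrite -mulrA => /(mulfI h0) ->; exists u. Qed.

Lemma divides_unit (u : R) f g : u \is a GRing.unit ->
  divides f (u * g) -> divides f g.
Proof.
move=> uU [h e]; exists (u^-1 * h).
by rewrite mulrCA -e mulrA mulVr // mul1r.
Qed.

Lemma divides_unitl (u : R) f g : u \is a GRing.unit ->
  divides f g -> divides (u * f) g.
Proof.
move=> uU [h ->]; exists (u^-1 * h).
by rewrite mulrACA divrr // mul1r.
Qed.

Definition prime_elt f := forall g h, divides f (g * h) -> divides f g \/ divides f h.

Lemma prime_exp f g h k : prime_elt f -> f != 0 -> ~ divides f g ->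
  divides (f ^+ k) (g * h) -> divides (f ^+ k) h.
Proof.
move=> fP f0 fg; elim: k h => [|k IH] h; first by exists h; rewrite mul1r.
rewrite exprS => -[u e].
have [//|[v hv]] : divides f g \/ divides f h.
  by apply: fP; exists (f ^+ k * u); rewrite e mulrA.
rewrite hv; apply: dividesM; first exact: divides_refl.
apply: IH; exists u; apply: (mulfI f0).
by rewrite mulrCA -hv e mulrA.
Qed.

Lemma prime_prod f (I : eqType) (r : seq I) (F : I -> R) : prime_elt f ->
  ~ divides f 1 -> divides f (\prod_(i <- r) F i) ->
  exists2 i, i \in r & divides f (F i).
Proof.
move=> fP f1; elim: r => [|i r IH]; first by rewrite big_nil => /f1.
rewrite big_cons => /fP[fi|/IH[j jr fj]]; first by exists i; rewrite ?mem_head.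
by exists j; rewrite ?inE ?jr ?orbT.
Qed.

Lemma prime_divides_exp f g k : prime_elt f -> ~ divides f 1 ->
  divides f (g ^+ k) -> divides f g.
Proof.
move=> fP f1; elim: k => [/f1|k IH] //.
by rewrite exprS => /fP[|/IH].
Qed.

Lemma coprime_prod_divides (I : eqType) (r : seq I) (F : I -> R) (m : I -> nat) f :
  uniq r -> {in r, forall i, prime_elt (F i) /\ F i != 0} ->
  {in r, forall i, ~ divides (F i) 1} ->
  {in r &, forall i j, i != j -> ~ divides (F i) (F j)} ->
  {in r, forall i, divides (F i ^+ m i) f} ->
  divides (\prod_(i <- r) F i ^+ m i) f.
Proof.
elim: r f => [|i r IH] f /=; first by rewrite big_nil; exists f; rewrite mul1r.
move=> /andP[ir ur] Fp F1 Fc Ff; rewrite big_cons.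
have [u fu] := Ff i (mem_head _ _).
rewrite fu; apply: dividesM; first exact: divides_refl.
apply: IH => // [j jr|j jr|j k jr kr|j jr].
- by apply: Fp; rewrite inE jr orbT.
- by apply: F1; rewrite inE jr orbT.
- by apply: Fc; rewrite inE (jr, kr) orbT.
have jr' : j \in i :: r by rewrite inE jr orbT.
have [jp j0] := Fp j jr'.
apply: (@prime_exp _ (F i ^+ m i)) => //; last by rewrite -fu; apply: Ff.
move=> /(prime_divides_exp jp (F1 j jr')).
by apply: Fc => //; [apply: mem_head | apply: contraNneq ir => <-].
Qed.

(** That is, g is a nonzerodivisor modulo f. In this form coprimality passes to products of such g
    and makes sense for a cofactor f whose factors are unknown. *)
Definition coprime_to f g := forall h, divides f (g * h) -> divides f h.

Lemma coprime_to1 f : coprime_to f 1.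
Proof. by move=> h; rewrite mul1r. Qed.

Lemma coprime_toM f g1 g2 : coprime_to f g1 -> coprime_to f g2 -> coprime_to f (g1 * g2).
Proof. by move=> c1 c2 h; rewrite -mulrA => /c1/c2. Qed.

Lemma coprime_toX f g k : coprime_to f g -> coprime_to f (g ^+ k).
Proof.
move=> c; elim: k => [|k IH]; first exact: coprime_to1.
by rewrite exprS; apply: coprime_toM.
Qed.

Lemma coprime_to_prime p f : prime_elt p -> p != 0 -> ~ divides p f -> coprime_to f p.
Proof.
move=> pP p0 pf h [u e].
have [/pf//|[v uv]] : divides p f \/ divides p u.
  by apply: pP; rewrite -e; apply/divides_mulr/divides_refl.
by exists v; apply: (mulfI p0); rewrite e uv mulrCA.
Qed.

End Divisibility.

(** * Linear substitutions and divisibility by a linear form *)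

Section LinearForms.
Variable K : fieldType.
Local Notation S n := {mpoly K[n]}.

Definition lform n (a : 'cV[K]_n) : S n := \sum_i (a i 0)%:MP * 'X_i.

(* Pullback of polynomial functions along the linear map v |-> v E of row vectors. *)
Definition lsub n k (E : 'M[K]_(k, n)) : S n -> S k :=
  comp_mpoly [tuple lform (col i E) | i < n].

HB.instance Definition _ n k (E : 'M[K]_(k, n)) :=
  GRing.RMorphism.on (@lsub n k E).

Lemma dhomog_size n d (f : S n) : f != 0 -> f \is d.-homog -> msize f = d.+1.
Proof.
move=> f0 fd; rewrite mpolySpred //; congr _.+1.
exact: dhomog_uniq f0 (dhomog_msize fd) fd.
Qed.

Lemma lformE n (a : 'cV[K]_n) : lform a = \sum_i a i 0 *: 'X_i.
Proof. by apply: eq_bigr => i _; rewrite mul_mpolyC. Qed.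

Lemma lformD n (a b : 'cV[K]_n) : lform (a + b) = lform a + lform b.
Proof. by rewrite -big_split; apply: eq_bigr => i _; rewrite mxE mpolyCD mulrDl. Qed.

Lemma lformZ n c (a : 'cV[K]_n) : lform (c *: a) = c%:MP * lform a.
Proof. by rewrite mulr_sumr; apply: eq_bigr => i _; rewrite mxE mpolyCM mulrA. Qed.

Lemma lform0 n : lform (0 : 'cV[K]_n) = 0.
Proof. by rewrite /lform big1 // => i _; rewrite mxE mpolyC0 mul0r. Qed.

Lemma lform_homog n (a : 'cV[K]_n) : lform a \is 1.-homog.
Proof.
rewrite lformE; apply: rpred_sum => i _; apply: rpredZ.
by rewrite dhomogX /= mdeg1.
Qed.

Lemma mcoeff_lform n (a : 'cV[K]_n) i : (lform a)@_(U_(i)) = a i 0.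
Proof.
rewrite lformE raddf_sum /= (bigD1 i) //= big1 => [|j ji].
  by rewrite mcoeffZ mcoeffXU eqxx mulr1 addr0.
by rewrite mcoeffZ mcoeffXU (negPf ji) mulr0.
Qed.

Lemma lform_eq0 n (a : 'cV[K]_n) : (lform a == 0) = (a == 0).
Proof.
apply/eqP/eqP => [a0|->]; last exact: lform0.
by apply/colP => i; rewrite mxE -mcoeff_lform a0 mcoeff0.
Qed.

Lemma lsubC n k (E : 'M[K]_(k, n)) c : lsub E c%:MP = c%:MP.
Proof. exact: comp_mpolyC. Qed.

Lemma lsubX n k (E : 'M[K]_(k, n)) i : lsub E 'X_i = lform (col i E).
Proof. by rewrite /lsub comp_mpolyXU -tnth_nth tnth_mktuple. Qed.

Lemma lsub_lform n k (E : 'M[K]_(k, n)) a : lsub E (lform a) = lform (E *m a).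
Proof.
rewrite rmorph_sum /=.
transitivity (\sum_i lform (a i 0 *: col i E)).
  by apply: eq_bigr => i _; rewrite rmorphM /= lsubC lsubX lformZ.
rewrite -(big_morph (@lform k) (@lformD k) (lform0 k)); congr lform.
apply/colP => j; rewrite summxE !mxE; apply: eq_bigr => i _.
by rewrite !mxE mulrC.
Qed.

Lemma mpoly_subring_ind n (P : S n -> Prop) :
  (forall c, P c%:MP) -> (forall i, P 'X_i) ->
  (forall f g, P f -> P g -> P (f + g)) ->
  (forall f g, P f -> P g -> P (f * g)) -> forall f, P f.
Proof.
move=> Pc PX PD PM f; rewrite [f]mpolyE.
apply: (big_ind P) => [||mm _]; [by rewrite -mpolyC0 | exact: PD |].
rewrite -mul_mpolyC; apply: (PM) => //.
rewrite mpolyXE_id; apply: (big_ind P) => [||i _]; [by rewrite -mpolyC1 | exact: PM |].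
elim: (mm i) => [|e IH]; first by rewrite expr0 -mpolyC1.
by rewrite exprS; apply: PM.
Qed.

Lemma lsub_comp n k l (E : 'M[K]_(k, n)) (G : 'M[K]_(l, k)) f :
  lsub G (lsub E f) = lsub (G *m E) f.
Proof.
elim/mpoly_subring_ind: f => [c|i|f g Hf Hg|f g Hf Hg].
- by rewrite !lsubC.
- by rewrite !lsubX lsub_lform !colE mulmxA.
- by rewrite !rmorphD /= Hf Hg.
- by rewrite !rmorphM /= Hf Hg.
Qed.

Lemma lsub1 n (f : S n) : lsub 1%:M f = f.
Proof.
elim/mpoly_subring_ind: f => [c|i|f g Hf Hg|f g Hf Hg].
- by rewrite lsubC.
- rewrite lsubX lformE (bigD1 i) //= !mxE eqxx scale1r big1 ?addr0 // => j ji.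
  by rewrite !mxE (negPf ji) scale0r.
- by rewrite rmorphD /= Hf Hg.
- by rewrite rmorphM /= Hf Hg.
Qed.

Lemma lsub_homog n k (E : 'M[K]_(k, n)) d f : f \is d.-homog -> lsub E f \is d.-homog.
Proof.
move=> fd; rewrite /lsub comp_mpolyEX big_seq; apply: rpred_sum => mm mf.
apply: rpredZ; rewrite comp_mpolyX -(dhomog_mf fd mf) /= mdegE.
elim/big_rec2: _ => [|i e g _ ge]; first exact: dhomog1.
apply: dhomogM => //; rewrite tnth_mktuple -[X in X.-homog]mul1n.
exact/dhomogMn/lform_homog.
Qed.

(* Substituting x - w(x) a for the coordinates projects onto the hyperplane
   ker a along the vector w; it changes a polynomial by a multiple of a. *)
Lemma lsub_proj n (a : 'cV[K]_n) (w : 'rV[K]_n) f :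
  divides (lform a) (f - lsub (1%:M - a *m w) f).
Proof.
elim/mpoly_subring_ind: f => [c|i|f g Hf Hg|f g Hf Hg].
- by rewrite lsubC subrr; apply: divides0.
- rewrite lsubX; exists (w 0 i)%:MP.
  rewrite -{1}['X_i](lsub1) lsubX -[lform a * _]mulrC -lformZ.
  apply/eqP; rewrite subr_eq -lformD; apply/eqP; congr lform.
  apply/colP => j; rewrite !mxE big_ord1; ring.
- by rewrite rmorphD opprD addrACA; apply: dividesD.
- have -> : f * g - lsub (1%:M - a *m w) (f * g) =
     (f - lsub (1%:M - a *m w) f) * g
     + lsub (1%:M - a *m w) f * (g - lsub (1%:M - a *m w) g).
    by rewrite rmorphM /=; ring.
  by apply: dividesD; [apply: divides_mulr | apply: divides_mull].
Qed.

Lemma exists_dual_vector n (a : 'cV[K]_n) : a != 0 -> exists w : 'rV[K]_n, w *m a = 1%:M.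
Proof.
move=> /cV0Pn[i ai]; exists ((a i 0)^-1 *: delta_mx 0 i).
by rewrite -scalemxAl -rowE; apply/rowP => j; rewrite !ord1 !mxE eqxx mulVf.
Qed.

Lemma divides_lformP n (a : 'cV[K]_n) (w : 'rV[K]_n) f : w *m a = 1%:M ->
  divides (lform a) f <-> lsub (1%:M - a *m w) f = 0.
Proof.
move=> wa; split=> [[g ->]|f0]; last by rewrite -[f]subr0 -f0; apply: lsub_proj.
rewrite rmorphM /= lsub_lform mulmxBl mul1mx -mulmxA wa mulmx1 subrr lform0.
by rewrite mul0r.
Qed.

(** The multiples of the form are the kernel of a substitution morphism, and its target is a
    domain. *)
Lemma lform_prime n (a : 'cV[K]_n) : a != 0 -> prime_elt (lform a).
Proof.
move=> /exists_dual_vector[w wa] g h /(divides_lformP _ wa)/eqP.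
rewrite rmorphM mulf_eq0 => /orP[]/eqP e; [left|right];
  exact/(divides_lformP _ wa).
Qed.

Lemma lform_dividesC n (a : 'cV[K]_n) c : a != 0 -> divides (lform a) c%:MP -> c = 0.
Proof.
move=> /exists_dual_vector[w wa] /(divides_lformP _ wa)/eqP.
by rewrite lsubC mpolyC_eq0 => /eqP.
Qed.

Lemma lform_ndivides1 n (a : 'cV[K]_n) : a != 0 -> ~ divides (lform a) 1.
Proof. by move=> a0; rewrite -mpolyC1 => /(lform_dividesC a0)/eqP; rewrite oner_eq0. Qed.

Lemma divides_lform n (a b : 'cV[K]_n) : a != 0 ->
  divides (lform a) (lform b) -> exists c, b = c *: a.
Proof.
move=> /exists_dual_vector[w wa] /(divides_lformP _ wa)/eqP.
rewrite lsub_lform lform_eq0 mulmxBl mul1mx -mulmxA [w *m b]mx11_scalar.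
rewrite mul_mx_scalar subr_eq0 => /eqP ->.
by exists ((w *m b) 0 0).
Qed.

End LinearForms.

(** * Saito's criterion *)

Section DomainMatrices.
Variable R : idomainType.

(** Padded with zero columns, B becomes a square matrix of determinant zero. *)
Lemma row_dependent r n (B : 'M[R]_(r, n)) : (n < r)%N ->
  exists2 v : 'rV[R]_r, v != 0 & v *m B = 0.
Proof.
move=> nr; pose B' : 'M[R]_r := \matrix_(i, j) oapp (B i) 0 (insub (j : nat)).
have /eqP/det0P[v v0 vB] : \det B' = 0.
  apply/eqP; rewrite -det_tr; apply/det0P.
  exists (delta_mx 0 (Ordinal nr)).
    by apply/rV0Pn; exists (Ordinal nr); rewrite mxE !eqxx oner_eq0.
  by rewrite -rowE; apply/rowP => j; rewrite !mxE insubF //= ltnn.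
exists v => //; apply/rowP => j.
have jr : (j < r)%N := ltn_trans (ltn_ord j) nr.
have /rowP/(_ (Ordinal jr)) := vB; rewrite !mxE => vBj; rewrite -[RHS]vBj.
by apply: eq_bigr => i _; rewrite mxE /= insubT //= => jn; congr (_ * B _ _); apply: val_inj.
Qed.

(** One block matrix has two factorisations into block triangular matrices; their determinants are
    the two sides. *)
Lemma det_1D_mul n (u : 'cV[R]_n) (v : 'rV[R]_n) :
  \det (1%:M + u *m v) = 1 + (v *m u) 0 0.
Proof.
pose A := block_mx 1%:M (- u) v (1%:M : 'M_1).
have e1 : A = block_mx 1%:M 0 v 1%:M *m block_mx 1%:M (- u) 0 (1%:M + v *m u).
  rewrite mulmx_block !(mul1mx, mul0mx, mulmx1, mulmx0, addr0, add0r) mulmxN.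
  by rewrite addrCA addNr addr0.
have e2 : A = block_mx (1%:M + u *m v) (- u) 0 1%:M *m block_mx 1%:M 0 v 1%:M.
  rewrite mulmx_block !(mul1mx, mul0mx, mulmx1, mulmx0, addr0, add0r) mulNmx.
  by rewrite addrK.
have := congr1 determinant e1; rewrite {}e2 !det_mulmx !det_ublock !det_lblock.
by rewrite !det1 !mul1r !mulr1 det_mx11 !mxE eqxx.
Qed.

(** Matrix form of [is_module_basis]: a change of basis becomes a matrix factor, which gives access
    to determinants. *)
Definition basis_mx r n (D : 'rV[R]_n -> Prop) (B : 'M[R]_(r, n)) : Prop :=
  [/\ forall i, D (row i B),
      forall theta, D theta -> exists f : 'rV_r, theta = f *m B
    & forall f : 'rV_r, f *m B = 0 -> f = 0].

Lemma basis_mx_factor r k n (D : 'rV[R]_n -> Prop) (B : 'M[R]_(r, n)) (M : 'M[R]_(k, n)) :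
  basis_mx D B -> (forall i, D (row i M)) -> exists F, M = F *m B.
Proof.
move=> [_ spB _] DM.
have /fin_all_exists[F MF] : forall i, exists f : 'rV_r, row i M = f *m B.
  by move=> i; apply: spB.
exists (\matrix_i F i); apply/row_matrixP => i.
by rewrite row_mul rowK MF.
Qed.

End DomainMatrices.

(** * Logarithmic derivations in coordinates and the determinant of a basis *)

Section Saito.
Variables (K : fieldType) (n : nat).
Local Notation S := {mpoly K[n]}.

Definition der_eval (theta : 'rV[S]_n) (a : 'cV[K]_n) : S :=
  (theta *m map_mx (@mpolyC n K) a) 0 0.

Lemma der_evalD theta eta a : der_eval (theta + eta) a = der_eval theta a + der_eval eta a.
Proof. by rewrite /der_eval mulmxDl mxE. Qed.

Lemma der_evalN theta a : der_eval (- theta) a = - der_eval theta a.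
Proof. by rewrite /der_eval mulNmx mxE. Qed.

Lemma der_eval0 a : der_eval 0 a = 0.
Proof. by rewrite /der_eval mul0mx mxE. Qed.

Lemma der_evalZ f theta a : der_eval (f *: theta) a = f * der_eval theta a.
Proof. by rewrite /der_eval -scalemxAl mxE. Qed.

Lemma der_eval_sum (I : finType) (F : I -> 'rV[S]_n) a :
  der_eval (\sum_i F i) a = \sum_i der_eval (F i) a.
Proof. by rewrite (big_morph (der_eval^~ a) (fun x y => der_evalD x y a) (der_eval0 a)). Qed.

Lemma der_eval_mul r (f : 'rV[S]_r) (B : 'M_(r, n)) a :
  der_eval (f *m B) a = \sum_i f 0 i * der_eval (row i B) a.
Proof.
rewrite mulmx_sum_row der_eval_sum; apply: eq_bigr => i _.
by rewrite der_evalZ.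
Qed.

Lemma der_eval_Zr theta c a : der_eval theta (c *: a) = c%:MP * der_eval theta a.
Proof. by rewrite /der_eval map_mxZ -scalemxAr mxE. Qed.

Lemma der_eval_Dr theta a b : der_eval theta (a + b) = der_eval theta a + der_eval theta b.
Proof. by rewrite /der_eval map_mxD mulmxDr mxE. Qed.

Lemma der_eval_const (v : 'rV[K]_n) a : der_eval (map_mx (@mpolyC n K) v) a = ((v *m a) 0 0)%:MP.
Proof. by rewrite /der_eval -map_mxM mxE. Qed.

Lemma unit_mpolyP (u : S) : divides u 1 -> exists2 c, c != 0 & u = c%:MP.
Proof.
move=> [h e]; have /andP[u0 h0] : (u != 0) && (h != 0).
  by rewrite -negb_or -mulf_eq0 -e oner_eq0.
have := congr1 (fun f => msize f) e; rewrite msize1 msizeM //.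
rewrite (mpolySpred _ u0) (mpolySpred _ h0) addSn addnS /= => -[/esym/eqP].
rewrite addn_eq0 => /andP[/eqP su _].
have uC : u = (u@_0)%:MP by apply: msize1_polyC; rewrite mpolySpred // su.
by exists u@_0 => //; rewrite -(mpolyC_eq0 n) -uC.
Qed.

Lemma mpolyC_unit c : c != 0 -> (c%:MP : S) \is a GRing.unit.
Proof. by move=> c0; apply: rmorph_unit; rewrite unitfE. Qed.

Lemma pihomogM_homog p e (g h : S) : g \is e.-homog ->
  pihomog mdeg p (g * h) = if (e <= p)%N then g * pihomog mdeg (p - e) h else 0.
Proof.
move=> ge; have gP i : g * pihomog mdeg i h \is (e + i).-homog.
  by apply: dhomogM ge (pihomogP _ _ _).
pose N := maxn (msize h) (p - e).+1.
rewrite [h in g * h](pihomog_partitionE (leq_maxl _ _ : (msize h <= N)%N)).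
rewrite mulr_sumr raddf_sum /=.
have [ep|pe] := leqP e p; last first.
  rewrite big1 // => i _; rewrite (pihomog_ne0 _ (gP i)) //.
  by rewrite neq_ltn (leq_trans pe (leq_addr _ _)) orbT.
have pN : (p - e < N)%N by rewrite leq_maxr.
rewrite (bigD1 (Ordinal pN)) //= big1 ?addr0 => [|i ne].
  by rewrite pihomog_dE //; have := gP (p - e)%N; rewrite subnKC.
apply: (pihomog_ne0 _ (gP i)); apply: contra ne => /eqP eip.
by apply/eqP/val_inj; rewrite /= -eip addKn.
Qed.

Lemma homog_factor e d (g h : S) : g != 0 -> h != 0 -> g \is e.-homog ->
  g * h \is d.-homog -> (e <= d)%N /\ h \is (d - e).-homog.
Proof.
move=> g0 h0 ge /pihomog_dE; rewrite (pihomogM_homog _ _ ge).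
case: ifP => [ed /(mulfI g0) <-|_ /esym/eqP]; first by split; rewrite ?pihomogP.
by rewrite mulf_eq0 (negPf g0) (negPf h0).
Qed.

Lemma det_homog (M : 'M[S]_n) (d : 'I_n -> nat) :
  (forall i j, M i j \is (d i).-homog) -> \det M \is (\sum_i d i).-homog.
Proof.
move=> Md; apply: rpred_sum => sg _.
rewrite mulr_sign; suff H : \prod_i M i (sg i) \is (\sum_i d i).-homog.
  by case: ifP => // _; rewrite dhomogN.
apply: (big_ind2 (fun (g : S) e => g \is e.-homog)); first exact: dhomog1.
  by move=> g e h e'; apply: dhomogM.
by move=> i _; apply: Md.
Qed.

Variables (I : eqType) (s : seq I) (a : I -> 'cV[K]_n).

Definition indep_forms := [/\ uniq s, {in s, forall i, a i != 0}
  & {in s &, forall i j, i != j -> ~ divides (lform (a i)) (lform (a j))}].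

Definition logmod (m : I -> nat) (theta : 'rV[S]_n) :=
  forall i, i \in s -> divides (lform (a i) ^+ m i) (der_eval theta (a i)).

Definition Qpoly (m : I -> nat) := \prod_(i <- s) lform (a i) ^+ m i.

Lemma logmodD m theta eta : logmod m theta -> logmod m eta -> logmod m (theta + eta).
Proof. by move=> H1 H2 i si; rewrite der_evalD; apply: dividesD; auto. Qed.

Lemma logmodZ m f theta : logmod m theta -> logmod m (f *: theta).
Proof. by move=> H1 i si; rewrite der_evalZ; apply: divides_mull; auto. Qed.

Lemma der_eval_pihomog p theta b :
  der_eval (map_mx (pihomog mdeg p) theta) b = pihomog mdeg p (der_eval theta b).
Proof.
rewrite /der_eval !mxE raddf_sum; apply: eq_bigr => i _.
by rewrite !mxE mulrC mul_mpolyC -linearZ /= -mul_mpolyC mulrC.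
Qed.

Lemma logmod_pihomog m p theta : logmod m theta -> logmod m (map_mx (pihomog mdeg p) theta).
Proof.
move=> Dt i si; rewrite der_eval_pihomog; have [g ->] := Dt i si.
rewrite (pihomogM_homog _ _ (dhomogMn (m i) (lform_homog (a i)))).
by case: ifP => _; [apply/divides_mulr/divides_refl | apply: divides0].
Qed.

Hypothesis arrA : indep_forms.

Lemma Qpoly_neq0 m : Qpoly m != 0.
Proof.
have [_ a0 _] := arrA; rewrite prodf_seq_neq0; apply/allP => i si /=.
by rewrite expf_neq0 // lform_eq0 a0.
Qed.

Lemma Qpoly_homog m : Qpoly m \is (\sum_(i <- s) m i).-homog.
Proof.
apply: (big_ind2 (fun (f : S) d => f \is d.-homog)); first exact: dhomog1.
  by move=> f d g e; apply: dhomogM.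
by move=> i _; have := dhomogMn (m i) (lform_homog (a i)); rewrite mul1n.
Qed.

Lemma Qpoly_divides m f : {in s, forall i, divides (lform (a i) ^+ m i) f} ->
  divides (Qpoly m) f.
Proof.
have [us a0 ac] := arrA; move=> sf.
apply: coprime_prod_divides => // i si; last exact/lform_ndivides1/a0.
by split; [apply/lform_prime/a0 | rewrite lform_eq0 a0].
Qed.

(** Cramer's rule: for a nonzero coefficient a_k of the form, a_k det M is an entry of adj M times
    the column of values of the rows on that form, and these values are divisible by the required
    power. *)
Lemma Qpoly_divides_det m (M : 'M[S]_n) : (forall i, logmod m (row i M)) ->
  divides (Qpoly m) (\det M).
Proof.
move=> DM; apply: Qpoly_divides => i si.
have [_ a0 _] := arrA; have /cV0Pn[k ak] := a0 i si.
apply: (divides_unit (mpolyC_unit ak)).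
have -> : (a i k 0)%:MP * \det M =
    (\adj M *m (M *m map_mx (@mpolyC n K) (a i))) k 0.
  by rewrite mulmxA mul_adj_mx mul_scalar_mx !mxE mulrC.
rewrite mxE; apply: divides_sum => j _; apply: divides_mull.
have -> : (M *m map_mx (@mpolyC n K) (a i)) j 0 = der_eval (row j M) (a i).
  by rewrite /der_eval -row_mul [RHS]mxE.
exact: DM.
Qed.

Lemma logmod_Qpoly m theta : logmod m (Qpoly m *: theta).
Proof.
move=> i si; have [us _ _] := arrA.
rewrite der_evalZ; apply: divides_mulr; rewrite /Qpoly (bigD1_seq i) //=.
exact/divides_mulr/divides_refl.
Qed.

(** D is caught between Q Der(S) and Der(S), both of rank n: too few elements cannot generate the
    former, too many are dependent in the latter. *)
Lemma basis_size m r (B : 'M[S]_(r, n)) : basis_mx (logmod m) B -> r = n.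
Proof.
move=> bB; have [DB spB freeB] := bB; case: (ltngtP r n) => // lt.
  have [F e] : exists F, (Qpoly m)%:M = F *m B.
    apply: (basis_mx_factor bB) => i.
    by rewrite -scalemx1 linearZ; apply: logmod_Qpoly.
  have [v v0 vF] := row_dependent F lt.
  have /eqP := congr1 (mulmx v) e.
  rewrite mulmxA vF mul0mx mul_mx_scalar scalemx_eq0 (negPf (Qpoly_neq0 m)).
  by rewrite (negPf v0).
by have [v v0 /freeB/eqP] := row_dependent B lt; rewrite (negPf v0).
Qed.

(** Write det B = Q u. For each i a matrix with rows in D and determinant Q_i^n alpha_i^(m i), where
    Q_i omits the i-th factor of Q, yields u | Q_i^(n-1), so alpha_i does not divide u. Hence u is
    coprime to every alpha_j and thus to Q_i; as it divides a power of Q_i, it is a unit. *)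
Lemma saito_det m (B : 'M[S]_n) : basis_mx (logmod m) B ->
  exists2 c, c != 0 & \det B = c%:MP * Qpoly m.
Proof.
move=> bB; have [DB spB freeB] := bB.
have [us a0 ac] := arrA.
have [u Bu] := Qpoly_divides_det DB.
suff /unit_mpolyP[c c0 uc] : divides u 1 by exists c; rewrite // Bu uc mulrC.
have H i : i \in s -> ~ divides (lform (a i)) u /\
   divides u ((\prod_(j <- s | j != i) lform (a j) ^+ m j) ^+ n.-1).
  move=> si; set Qi := \prod_(j <- s | _) _.
  have [w wa] := exists_dual_vector (a0 i si).
  set al := lform (a i).
  (* Since w a = 1, the matrix 1 + (al^(m i) - 1) a w multiplies the column a by al^(m i) and has
     determinant al^(m i); the factor [Qi] takes care of the other forms. *)
  pose N : 'M[S]_n := Qi *: (1%:M + ((al ^+ m i - 1) *: map_mx (@mpolyC n K) (a i))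
                                      *m map_mx (@mpolyC n K) w).
  have NH k b : der_eval (row k N) b =
     Qi * ((b k 0)%:MP + (al ^+ m i - 1) * (a i k 0)%:MP * ((w *m b) 0 0)%:MP).
    rewrite /der_eval -row_mul mxE /N -scalemxAl mxE; congr (_ * _).
    rewrite mulmxDl mul1mx -mulmxA -map_mxM mxE; congr (_ + _); first by rewrite mxE.
    by rewrite mxE big_ord1 !mxE.
  have DN k : logmod m (row k N).
    move=> j sj; rewrite NH; have [->|ji] := eqVneq j i.
      exists (Qi * (a i k 0)%:MP); rewrite wa !mxE eqxx mulr1n mpolyC1 -/al; ring.
    apply: divides_mulr; rewrite /Qi -big_filter (bigD1_seq j) /= ?filter_uniq ?mem_filter ?ji //.
    exact/divides_mulr/divides_refl.
  have [F NF] := basis_mx_factor bB DN.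
  have wa' : (map_mx (@mpolyC n K) w *m map_mx (@mpolyC n K) (a i)) 0 0 = 1.
    by rewrite -map_mxM wa !mxE eqxx rmorph1.
  have detN : \det N = Qi ^+ n * al ^+ m i.
    rewrite detZ det_1D_mul; congr (_ * _).
    by rewrite -scalemxAr mxE wa' mulr1 addrC subrK.
  have n0 : (0 < n)%N.
    by have /cV0Pn[k _] := a0 i si; apply: leq_trans (ltn_ord k).
  have QQi : Qpoly m = al ^+ m i * Qi by rewrite /Qpoly (bigD1_seq i).
  have uF : u * \det F = Qi ^+ n.-1.
    apply: (mulfI (Qpoly_neq0 m)); rewrite mulrA -Bu mulrC -det_mulmx -NF detN QQi.
    have -> : Qi ^+ n = Qi * Qi ^+ n.-1 by rewrite -exprS prednK.
    by ring.
  have aQi : ~ divides al Qi.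
    rewrite /Qi -big_filter => /prime_prod[||j].
    - exact/lform_prime/a0.
    - exact/lform_ndivides1/a0.
    rewrite mem_filter => /andP[ji sj] /prime_divides_exp[||h].
    - exact/lform_prime/a0.
    - exact/lform_ndivides1/a0.
    by move=> e; apply: (ac i j) => //; rewrite 1?eq_sym //; exists h.
  split; last by exists (\det F); rewrite uF.
  move=> au; apply: aQi; apply: (@prime_divides_exp _ _ _ n.-1).
  - exact/lform_prime/a0.
  - exact/lform_ndivides1/a0.
  by rewrite -uF; apply: divides_mulr.
case: (posnP (size s)) => [/size0nil s0|]; last first.
  rewrite -has_predT => /hasP[i si _]; have [_ uQ] := H i si.
  suff cu : coprime_to u ((\prod_(j <- s | j != i) lform (a j) ^+ m j) ^+ n.-1).
    by apply: cu; rewrite mulr1.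
  apply: coprime_toX; rewrite big_seq_cond.
  apply: (big_ind (coprime_to u)); [exact: coprime_to1 | exact: coprime_toM |].
  move=> j /andP[sj _]; apply: coprime_toX; apply: coprime_to_prime.
  - exact/lform_prime/a0.
  - by rewrite lform_eq0 a0.
  - by have [] := H j sj.
have [F BF] : exists F, 1%:M = F *m B.
  by apply: (basis_mx_factor bB) => i j; rewrite s0.
exists (\det F); have := congr1 determinant BF; rewrite det1 det_mulmx Bu.
by rewrite /Qpoly s0 big_nil mul1r mulrC.
Qed.

(** With M = F B, comparing determinants makes det F a nonzero constant, so F is invertible and M
    generates what B does. *)
Lemma basis_of_det m (B M : 'M[S]_n) c : basis_mx (logmod m) B ->
  (forall i, logmod m (row i M)) -> c != 0 -> \det M = c%:MP * Qpoly m ->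
  basis_mx (logmod m) M.
Proof.
move=> bB DM c0 detM; have [DB spB freeB] := bB.
have [F MF] := basis_mx_factor bB DM.
have [c' c'0 detB] := saito_det bB.
have detF : \det F * c'%:MP = c%:MP.
  by apply: (mulIf (Qpoly_neq0 m)); rewrite -mulrA -detB -det_mulmx -MF.
have uF : F \in unitmx.
  have : \det F * c'%:MP \is a GRing.unit by rewrite detF mpolyC_unit.
  by rewrite unitrM => /andP[].
split=> // [theta /spB[f ->]|f].
  by exists (f *m invmx F); rewrite MF mulmxA mulmxKV.
rewrite MF mulmxA => /freeB fF.
by rewrite -[f](mulmxK uF) fF mul0mx.
Qed.

Lemma saito_degree m (M : 'M[S]_n) (d : 'I_n -> nat) : basis_mx (logmod m) M ->
  (forall i j, M i j \is (d i).-homog) -> (\sum_i d i = \sum_(i <- s) m i)%N.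
Proof.
move=> /saito_det[c c0 e] /det_homog; rewrite {}e mul_mpolyC => Md.
have Qd : c *: Qpoly m \is (\sum_(i <- s) m i).-homog by apply/rpredZ/Qpoly_homog.
by apply: dhomog_uniq Md Qd; rewrite scaler_eq0 negb_or c0 Qpoly_neq0.
Qed.

(** Expand det B over the homogeneous components of its rows. As det B is a constant times Q, some
    choice of one component per row has a determinant with nonzero part of degree |m|. This
    determinant is homogeneous and divisible by Q, hence a constant times Q, and the chosen
    components form a basis. *)
Lemma homog_basis m (B : 'M[S]_n) : basis_mx (logmod m) B ->
  exists (M : 'M[S]_n) (d : 'I_n -> nat),
    [/\ basis_mx (logmod m) M, forall i, row i M != 0 & forall i j, M i j \is (d i).-homog].
Proof.
move=> bB; have [DB _ _] := bB; have [c c0 detB] := saito_det bB.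
pose N := \max_i \max_j msize (B i j).
have BN i j : B i j = \sum_(p < N) pihomog mdeg p (B i j).
  apply: pihomog_partitionE; apply: leq_trans (leq_bigmax i).
  exact: (leq_bigmax j).
pose Bf (f : {ffun 'I_n -> 'I_N}) : 'M[S]_n := \matrix_(i, j) pihomog mdeg (f i) (B i j).
have detBf f : \det (Bf f) \is (\sum_i f i).-homog.
  by apply: det_homog => i j; rewrite mxE pihomogP.
have detE : \det B = \sum_f \det (Bf f).
  rewrite /determinant exchange_big /=; apply: eq_bigr => sg _.
  rewrite -mulr_sumr; congr (_ * _).
  rewrite (eq_bigr (fun i => \sum_(p < N) pihomog mdeg p (B i (sg i)))); last by [].
  rewrite bigA_distr_bigA; apply: eq_bigr => f _; apply: eq_bigr => i _.
  by rewrite mxE.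
pose q := (\sum_(i <- s) m i)%N.
have Qq : \det B \is q.-homog by rewrite detB mul_mpolyC; apply/rpredZ/Qpoly_homog.
have : \det B != 0 by rewrite detB mulf_neq0 ?Qpoly_neq0 ?mpolyC_eq0.
rewrite -(pihomog_dE Qq) detE raddf_sum /=.
case: (pickP (fun f => pihomog mdeg q (\det (Bf f)) != 0)) => [f hf _|h]; last first.
  by rewrite big1 ?eqxx // => f _; apply/eqP; have := h f; rewrite /= => /negbFE.
have Df i : logmod m (row i (Bf f)).
  have -> : row i (Bf f) = map_mx (pihomog mdeg (f i)) (row i B).
    by apply/rowP => j; rewrite !mxE.
  exact: logmod_pihomog.
have fq : (\sum_i f i)%N = q.
  by apply/eqP; apply: contraNT hf => ne; rewrite (pihomog_ne0 ne (detBf f)).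
have df0 : \det (Bf f) != 0 by apply: contraNneq hf => ->; rewrite raddf0.
have [u eu] := Qpoly_divides_det Df.
have u0 : u != 0 by apply: contraNneq df0 => u0; rewrite eu u0 mulr0.
have /eqP : msize (\det (Bf f)) = msize (Qpoly m).
  rewrite (dhomog_size (Qpoly_neq0 m) (Qpoly_homog m)).
  by rewrite (dhomog_size df0 (detBf f)) fq.
rewrite eu msizeM ?Qpoly_neq0 // [msize u]mpolySpred // addnS /=.
rewrite -[X in _ == X]addn0 eqn_add2l => /eqP su.
have uC : u = (u@_0)%:MP by apply: msize1_polyC; rewrite mpolySpred // su.
exists (Bf f), (fun i => nat_of_ord (f i)); split.
- apply: (@basis_of_det m B _ u@_0 bB Df); last by rewrite eu mulrC -uC.
  by rewrite -(mpolyC_eq0 n) -uC.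
- move=> i; apply: contraNneq df0 => r0; apply/det0P; exists (delta_mx 0 i).
    by apply/rV0Pn; exists i; rewrite mxE !eqxx oner_eq0.
  by rewrite -rowE.
- by move=> i j; rewrite mxE pihomogP.
Qed.

End Saito.

(** * Multiarrangements of rank two *)

Section BinaryForms.
Variables (K : fieldType) (n : nat).
Local Notation S := {mpoly K[n]}.
Implicit Types (a b : 'cV[K]_n) (f g : S).

(** The degree d part of the subalgebra generated by the two linear forms; the recursion allows
    induction on the degree and a change of the two forms without choosing coordinates. *)
Fixpoint binform a b d f : Prop :=
  if d is d'.+1 then exists g h,
    [/\ binform a b d' g, binform a b d' h & f = lform a * g + lform b * h]
  else exists c, f = c%:MP.

Lemma binform0 a b d : binform a b d 0.
Proof.
elim: d => [|d IH] /=; first by exists 0; rewrite mpolyC0.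
by exists 0, 0; rewrite !mulr0 addr0.
Qed.

Lemma binformD a b d f g : binform a b d f -> binform a b d g -> binform a b d (f + g).
Proof.
elim: d f g => [|d IH] f g /=.
  by move=> [c ->] [c' ->]; exists (c + c'); rewrite mpolyCD.
move=> [g1 [h1 [G1 H1 ->]]] [g2 [h2 [G2 H2 ->]]].
exists (g1 + g2), (h1 + h2); split; [exact: IH|exact: IH|ring].
Qed.

Lemma binformC a b d c f : binform a b d f -> binform a b d (c%:MP * f).
Proof.
elim: d f => [|d IH] f /=.
  by move=> [c' ->]; exists (c * c'); rewrite mpolyCM.
move=> [g1 [h1 [G1 H1 ->]]].
exists (c%:MP * g1), (c%:MP * h1); split; [exact: IH|exact: IH|ring].
Qed.

Lemma binform_change a b a' b' d f :
  (exists x y, a = x *: a' + y *: b') -> (exists x y, b = x *: a' + y *: b') ->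
  binform a b d f -> binform a' b' d f.
Proof.
move=> [p [q ea]] [r [t eb]]; elim: d f => [|d IH] f //= [g [h [/IH G /IH H ->]]].
exists (p%:MP * g + r%:MP * h), (q%:MP * g + t%:MP * h).
split; try by apply: binformD; apply: binformC.
rewrite ea eb !lformD !lformZ; ring.
Qed.

Lemma binform_mul a b x y d f : binform a b d f ->
  binform a b d.+1 (lform (x *: a + y *: b) * f).
Proof.
move=> F; exists (x%:MP * f), (y%:MP * f); split; try exact: binformC.
by rewrite lformD !lformZ; ring.
Qed.

Lemma binform_mulX a b x y k d f : binform a b d f ->
  binform a b (k + d) (lform (x *: a + y *: b) ^+ k * f).
Proof.
move=> F; elim: k => [|k IH]; first by rewrite expr0 mul1r.
by rewrite exprS -mulrA; apply: binform_mul.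
Qed.

Lemma binform_homog a b d f : binform a b d f -> f \is d.-homog.
Proof.
elim: d f => [|d IH] f /=.
  by move=> [c ->]; rewrite -[c%:MP]mulr1 mul_mpolyC; apply/rpredZ/dhomog1.
by move=> [g [h [/IH G /IH H ->]]]; rewrite rpredD //; apply: (@dhomogM _ _ _ 1) => //;
  apply: lform_homog.
Qed.

Lemma binform_lead a b d f : binform a b d f ->
  exists c g, f = c%:MP * lform b ^+ d + lform a * g /\
    (if d is d'.+1 then binform a b d' g else g = 0).
Proof.
elim: d f => [|d IH] f /=.
  by move=> [c ->]; exists c, 0; rewrite mulr1 mulr0 addr0.
move=> [g [h [G /IH[c [k [-> Hk]]] ->]]].
exists c, (g + lform b * k); split; first by rewrite exprS; ring.
apply: binformD => //; case: d Hk {IH G} => [->|d Hk]; first by rewrite mulr0; apply: binform0.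
by have := binform_mul 0 1 Hk; rewrite scale0r add0r scale1r.
Qed.

Lemma binform_divides a b d m f : a != 0 -> ~ divides (lform a) (lform b) ->
  binform a b d f -> divides (lform a ^+ m) f ->
  exists c e k, f = lform a ^+ m * (c%:MP * lform b ^+ e + lform a * k) /\
    (c = 0 \/ (e + m)%N = d).
Proof.
move=> a0 ab F fm.
have la0 : lform a != 0 by rewrite lform_eq0.
suff [->|[md [g [-> G]]]] : f = 0 \/ (m <= d)%N /\ exists g, f = lform a ^+ m * g /\
     binform a b (d - m) g.
- by exists 0, 0%N, 0; rewrite mpolyC0 mul0r mulr0 addr0 mulr0; split; last left.
- have [c [k [-> _]]] := binform_lead G.
  by exists c, (d - m)%N, k; split; last (right; rewrite subnK).
elim: m fm => [|m IH] fm.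
  by right; split=> //; exists f; rewrite subn0 mul1r.
have [||[md [g [fg G]]]] := IH; first by apply: divides_trans fm; apply: divides_exp_leq.
  by left.
have ag : divides (lform a) g.
  apply: (@divides_cancel _ _ _ (lform a ^+ m)); first by rewrite expf_neq0.
  by rewrite -fg -exprSr.
have [c [k [gk Hk]]] := binform_lead G.
have c0 : c = 0.
  have [//|] := eqVneq c 0 => c0.
  have : divides (lform a) (lform b ^+ (d - m)).
    apply: (divides_unit (mpolyC_unit n c0)).
    have -> : c%:MP * lform b ^+ (d - m) = g - lform a * k by rewrite gk addrK.
    by apply: dividesB => //; exists k.
  by move=> /(prime_divides_exp (lform_prime a0) (lform_ndivides1 a0)).
move: gk; rewrite c0 mpolyC0 mul0r add0r => gk.
case: (ltngtP m d) md => // [md _|mE _]; last first.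
  by left; move: Hk; rewrite mE subnn => k0; rewrite fg gk k0 !mulr0.
right; split=> //; exists k; rewrite exprSr -mulrA -gk; split=> //.
by move: Hk; rewrite -(subnSK md).
Qed.

End BinaryForms.

(** * Bases in rank two and their leading terms along one hyperplane *)

Section RankTwo.
Variables (K : fieldType) (n : nat) (I : eqType) (s : seq I).
Local Notation S := {mpoly K[n]}.
Variables (a b : 'cV[K]_n) (p q : I -> K).
Hypotheses (a0 : a != 0) (ndab : ~ divides (lform a) (lform b)).

Let ai i := p i *: a + q i *: b.

Hypothesis arrA : indep_forms s ai.

(* A pair u stands for a derivation with values u.1 and u.2 on the forms a and b. *)
Definition pair_eval i (u : S * S) : S := (p i)%:MP * u.1 + (q i)%:MP * u.2.

Definition logder2 (m : I -> nat) (u : S * S) :=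
  forall i, i \in s -> divides (lform (ai i) ^+ m i) (pair_eval i u).

Definition det2 (u w : S * S) := u.1 * w.2 - u.2 * w.1.

Definition pairform d (u : S * S) := binform a b d u.1 /\ binform a b d u.2.

Lemma Qpoly_divides_det2 m u w : logder2 m u -> logder2 m w ->
  divides (Qpoly s ai m) (det2 u w).
Proof.
move=> Du Dw; apply: Qpoly_divides => // i si.
have [_ ai0 _] := arrA; have := ai0 i si.
have [p0|p0 _] := eqVneq (p i) 0; last first.
  apply: (divides_unit (mpolyC_unit n p0)).
  rewrite (_ : _ * _ = pair_eval i u * w.2 - pair_eval i w * u.2); last first.
    by rewrite /pair_eval /det2; ring.
  by apply: dividesB; apply: divides_mulr; auto.
rewrite /ai p0 scale0r add0r => qb.
have q0 : q i != 0 by apply: contraNneq qb => ->; rewrite scale0r.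
apply: (divides_unit (mpolyC_unit n q0)).
rewrite (_ : _ * _ = pair_eval i w * u.1 - pair_eval i u * w.1); last first.
  by rewrite /pair_eval /det2; ring.
have := dividesB (divides_mulr u.1 (Dw i si)) (divides_mulr w.1 (Du i si)).
by rewrite /ai p0 scale0r add0r.
Qed.

Lemma cramer2 m u w c : logder2 m u -> logder2 m w -> c != 0 ->
  det2 u w = c%:MP * Qpoly s ai m -> forall h, logder2 m h ->
  exists x y, h.1 = x * u.1 + y * w.1 /\ h.2 = x * u.2 + y * w.2.
Proof.
move=> Du Dw c0 e h Dh.
have [x hx] := Qpoly_divides_det2 Dh Dw.
have [y hy] := Qpoly_divides_det2 Du Dh.
have Q0 := Qpoly_neq0 arrA m.
exists (c^-1%:MP * x), (c^-1%:MP * y).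
have cc : (c%:MP : S) * c^-1%:MP = 1 by rewrite -mpolyCM divff // mpolyC1.
have cQ0 : c%:MP * Qpoly s ai m != 0 by rewrite mulf_neq0 // mpolyC_eq0.
split; apply: (mulfI cQ0).
  rewrite (_ : _ * (_ + _) = (c%:MP * c^-1%:MP) *
     ((Qpoly s ai m * x) * u.1 + (Qpoly s ai m * y) * w.1)); last by ring.
  by rewrite cc -hx -hy -e /det2; ring.
rewrite (_ : _ * (_ + _) = (c%:MP * c^-1%:MP) *
     ((Qpoly s ai m * x) * u.2 + (Qpoly s ai m * y) * w.2)); last by ring.
by rewrite cc -hx -hy -e /det2; ring.
Qed.

(** By [cramer2] the determinant condition makes u, w generate. The degrees are recorded because one
    of them becomes the Euler multiplicity. *)
Definition prebasis m d1 d2 u w :=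
  [/\ pairform d1 u /\ pairform d2 w, logder2 m u /\ logder2 m w,
      exists2 c, c != 0 & det2 u w = c%:MP * Qpoly s ai m
    & (d1 + d2 = \sum_(i <- s) m i)%N].

Lemma prebasis_sym m d1 d2 u w : prebasis m d1 d2 u w -> prebasis m d2 d1 w u.
Proof.
move=> [[? ?] [? ?] [c c0 e] E]; split=> //; last by rewrite addnC.
exists (- c); first by rewrite oppr_eq0.
by rewrite mpolyCN mulNr -e /det2; ring.
Qed.

Definition raised_mult i0 (m : I -> nat) i := (m i + (i == i0))%N.

Lemma Qpoly_raised i0 m : i0 \in s ->
  Qpoly s ai (raised_mult i0 m) = lform (ai i0) * Qpoly s ai m.
Proof.
move=> si; have [us _ _] := arrA; rewrite /Qpoly.
under eq_bigr do rewrite exprD.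
rewrite big_split /= mulrC; congr (_ * _).
rewrite (bigD1_seq i0) //= eqxx big1 ?mulr1 // => i /negPf -> //.
Qed.

Lemma sum_raised i0 m : i0 \in s ->
  (\sum_(i <- s) raised_mult i0 m i = (\sum_(i <- s) m i).+1)%N.
Proof.
move=> si; have [us _ _] := arrA.
rewrite big_split /= -addn1; congr (_ + _)%N.
by rewrite (bigD1_seq i0) //= eqxx big1 ?addn0 // => i /negPf ->.
Qed.

Lemma logder2_raised i0 m u : logder2 m u ->
  divides (lform (ai i0) ^+ (m i0).+1) (pair_eval i0 u) -> logder2 (raised_mult i0 m) u.
Proof.
move=> Du ui i si; rewrite /raised_mult; have [->|_] := eqVneq i i0; first by rewrite addn1.
by rewrite addn0; apply: Du.
Qed.

(* Modulo the i0-th form, both values are multiples of powers of one linear form,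
   so the one of larger degree can be cancelled against the other. *)
Lemma prebasis_prepare i0 b' m d1 d2 u w : i0 \in s ->
  ~ divides (lform (ai i0)) (lform b') ->
  (exists x y, b' = x *: a + y *: b) ->
  (exists x y, a = x *: ai i0 + y *: b') -> (exists x y, b = x *: ai i0 + y *: b') ->
  prebasis m d1 d2 u w ->
  exists d1 d2 u w c e k, [/\ prebasis m d1 d2 u w, logder2 (raised_mult i0 m) w,
     c != 0, pair_eval i0 u = lform (ai i0) ^+ m i0 * (c%:MP * lform b' ^+ e + lform (ai i0) * k)
     & (e + m i0 = d1)%N].
Proof.
move=> si nab' [x' [y' eb']] ha hb.
have [us ai0 _] := arrA; have ai00 := ai0 i0 si.
have lead d v : pairform d v -> logder2 m v -> exists c e k,
    pair_eval i0 v = lform (ai i0) ^+ m i0 * (c%:MP * lform b' ^+ e + lform (ai i0) * k) /\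
    (c = 0 \/ (e + m i0)%N = d).
  move=> [V1 V2] Dv; apply: binform_divides => //; last exact: Dv.
  by apply: (binform_change ha hb); apply: binformD; apply: binformC.
have zero v e k : logder2 m v -> pair_eval i0 v = lform (ai i0) ^+ m i0 *
     ((0 : K)%:MP * lform b' ^+ e + lform (ai i0) * k) -> logder2 (raised_mult i0 m) v.
  move=> Dv ev; apply: logder2_raised => //; rewrite ev mpolyC0 mul0r add0r mulrA -exprSr.
  exact/divides_mulr/divides_refl.
wlog le12 : d1 d2 u w / (d1 <= d2)%N => [H|] pb.
  have [|/ltnW] := leqP d1 d2; first by move=> le; apply: H le pb.
  by move=> le; apply: H le (prebasis_sym pb).
have [[U W] [Du Dw] [c0 c00 det12] sum12] := pb.
have [cu [eu [ku [Eu hu]]]] := lead _ _ U Du.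
have [cw [ew [kw [Ew hw]]]] := lead _ _ W Dw.
have [cu0|cu0] := eqVneq cu 0; last first.
  have {}hu : (eu + m i0)%N = d1 by case: hu => // /eqP; rewrite (negPf cu0).
  pose z : S := (cw / cu)%:MP * lform b' ^+ (d2 - d1).
  pose w' := (w.1 - z * u.1, w.2 - z * u.2).
  have zf f : binform a b d1 f -> binform a b d2 (z * f).
    move=> F; rewrite /z -mulrA eb'; apply: binformC.
    by rewrite -{1}(subnK le12); apply: binform_mulX.
  have apw' : pair_eval i0 w' = pair_eval i0 w - z * pair_eval i0 u.
    by rewrite /pair_eval /w' /=; ring.
  have Dw' : logder2 m w'.
    move=> i i_s; have -> : pair_eval i w' = pair_eval i w - z * pair_eval i u.
      by rewrite /pair_eval /w' /=; ring.
    by apply: dividesB; [|apply: divides_mull]; auto.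
  exists d1, d2, u, w', cu, eu, ku; split=> //.
    split=> //.
      by split=> //; case: U W => U1 U2 [W1 W2]; split; rewrite /w' /= -mulNr;
        apply: binformD => //; rewrite mulNr -mulrN -mulN1r -mpolyC1 -mpolyCN;
        apply: zf; apply: binformC.
    by exists c0 => //; rewrite -det12 /det2 /w' /=; ring.
  apply: (logder2_raised Dw'); rewrite apw' Ew Eu.
  have cE : cw%:MP * lform b' ^+ ew = z * (cu%:MP * lform b' ^+ eu).
    rewrite /z; case: hw => [->|hw]; first by rewrite !mul0r.
    have -> : ew = (d2 - d1 + eu)%N by lia.
    rewrite exprD (_ : _ * _ * (_ * _) = ((cw / cu)%:MP * cu%:MP) *
       (lform b' ^+ (d2 - d1) * lform b' ^+ eu)); last by ring.
    by rewrite -mpolyCM divfK.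
  exists (kw - z * ku); rewrite cE exprSr; ring.
have Du' : logder2 (raised_mult i0 m) u by apply: (zero u eu ku) => //; rewrite -cu0.
(* Here u already satisfies the raised condition, so u and w exchange roles. *)
have [cw0|cw0] := eqVneq cw 0; last first.
  exists d2, d1, w, u, cw, ew, kw; split=> //; first exact: prebasis_sym.
  by case: hw => // /eqP; rewrite (negPf cw0).
have Dw' : logder2 (raised_mult i0 m) w by apply: (zero w ew kw) => //; rewrite -cw0.
(* If both satisfied the raised condition, the i0-th form times Q would divide a nonzero constant
   times Q. *)
have := Qpoly_divides_det2 Du' Dw'; rewrite det12 Qpoly_raised // ![_ * Qpoly _ _ _]mulrC.
move=> /(divides_cancel (Qpoly_neq0 arrA m)) /(lform_dividesC ai00) /eqP.
by rewrite (negPf c00).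
Qed.

Lemma prebasis_raised i0 m d1 d2 u w : i0 \in s -> prebasis m d1 d2 u w ->
  logder2 (raised_mult i0 m) w ->
  prebasis (raised_mult i0 m) d1.+1 d2 (lform (ai i0) * u.1, lform (ai i0) * u.2) w.
Proof.
move=> si [[[U1 U2] W] [Du Dw] [c c0 e] E] Dw'; split=> //.
- by split=> //; split; apply: binform_mul.
- split=> // i i_s; have -> : pair_eval i (lform (ai i0) * u.1, lform (ai i0) * u.2)
      = lform (ai i0) * pair_eval i u by rewrite /pair_eval /=; ring.
  rewrite /raised_mult; have [->|_] := eqVneq i i0; last first.
    by rewrite addn0; apply: divides_mull; apply: Du.
  by rewrite addn1 exprS; apply: dividesM; [apply: divides_refl | apply: Du].
- exists c => //; rewrite Qpoly_raised // (_ : det2 _ _ = lform (ai i0) * det2 u w).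
    by rewrite e; ring.
  by rewrite /det2 /=; ring.
- by rewrite sum_raised // -E.
Qed.

Lemma prebasis_exists m : exists d1 d2 u w, prebasis m d1 d2 u w.
Proof.
move: {2}(\sum_(i <- s) m i)%N (erefl (\sum_(i <- s) m i)%N) => N.
elim: N m => [|N IH] m mN.
  have m0 i : i \in s -> m i = 0%N.
    move=> si; have [us _ _] := arrA; move/eqP: mN.
    by rewrite (bigD1_seq i) //= addn_eq0 => /andP[/eqP].
  exists 0%N, 0%N, (1, 0), (0, 1); split; last by rewrite mN.
  - by split; split=> /=; by [exists 0; rewrite mpolyC0 | exists 1; rewrite mpolyC1].
  - by split=> i si; rewrite m0 // expr0;
      exists (pair_eval i (1,0)) + exists (pair_eval i (0, 1)); rewrite mul1r.
  - exists 1; first exact: oner_neq0.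
    rewrite /det2 /= mulr1 mulr0 subr0 mpolyC1 mul1r /Qpoly big_seq big1 // => i si.
    by rewrite m0.
have [i0 si mi0] : exists2 i, i \in s & (0 < m i)%N.
  apply/hasP; apply: contra_eqT mN => /hasPn h.
  by rewrite big_seq big1 // => i /h; rewrite -eqn0Ngt => /eqP.
pose m' i := (m i - (i == i0))%N.
have mE : raised_mult i0 m' =1 m.
  by move=> i; rewrite /raised_mult /m'; have [->|] := eqVneq i i0; rewrite ?subn0 ?addn0 // subnK.
have [us ai0 _] := arrA; have ai00 := ai0 i0 si.
have [|d1 [d2 [u [w pb]]]] := IH m'.
  by apply/eqP; rewrite -eqSS -(sum_raised _ si) -mN; apply/eqP/eq_bigr => i _; rewrite mE.
(* [b'] completes the i0-th form to a basis of the span of a and b: it is b if that form is a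
   multiple of a, and a otherwise. *)
have [b' [h1 h2 h3 h4]] : exists b', [/\ ~ divides (lform (ai i0)) (lform b'),
  exists x y, b' = x *: a + y *: b, exists x y, a = x *: ai i0 + y *: b' &
  exists x y, b = x *: ai i0 + y *: b'].
  have [q0|q0] := eqVneq (q i0) 0.
    have eai : ai i0 = p i0 *: a by rewrite /ai q0 scale0r addr0.
    have p0 : p i0 != 0 by apply: contraNneq ai00; rewrite eai => ->; rewrite scale0r.
    exists b; split.
    - rewrite eai lformZ => -[g hg]; apply: ndab; exists ((p i0)%:MP * g).
      by rewrite hg; ring.
    - by exists 0, 1; rewrite scale0r add0r scale1r.
    - by exists (p i0)^-1, 0; rewrite eai scalerA mulVf // scale1r scale0r addr0.
    - by exists 0, 1; rewrite scale0r add0r scale1r.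
  exists a; split.
  - move=> /(divides_lform ai00)[c ec].
    have c0 : c != 0 by apply: contraNneq a0 => c0; rewrite ec c0 scale0r.
    apply: ndab; exists ((q i0)^-1%:MP * (c^-1 - p i0)%:MP).
    rewrite -mpolyCM mulrC -lformZ; congr lform.
    have : c^-1 *: a = ai i0 by rewrite {1}ec scalerA mulVf // scale1r.
    rewrite /ai -scalerA scalerBl => ->; rewrite addrC addKr.
    by rewrite scalerA mulVf // scale1r.
  - by exists 1, 0; rewrite scale0r addr0 scale1r.
  - by exists 0, 1; rewrite scale0r add0r scale1r.
  - exists (q i0)^-1, (- ((q i0)^-1 * p i0)).
    by rewrite /ai scalerDr !scalerA mulVf // scale1r scaleNr addrAC addrN add0r.
have [e1 [e2 [u' [w' [c [e [k [pb' Dw' _ _ _]]]]]]]] := prebasis_prepare si h1 h2 h3 h4 pb.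
have [? [H1 H2] [c1 c10 H3] H4] := prebasis_raised si pb' Dw'.
exists e1.+1, e2, (lform (ai i0) * u'.1, lform (ai i0) * u'.2), w'; split=> //.
- by split=> i i_s; rewrite -mE; auto.
- by exists c1 => //; rewrite H3 /Qpoly; congr (_ * _); apply: eq_bigr => i _; rewrite mE.
- by rewrite H4; apply: eq_bigr => i _; rewrite mE.
Qed.

(** A prepared pair u, w for the multiplicity lowered at i0 serves twice. The pair a u, w is a basis
    for m, in which w plays theta_X, with d = m^*(X), and a u plays psi_X. For the lowered
    multiplicity, w.1 is divisible by a^(m i0) and u.1 only by one power less, so the leading
    exponent e of u governs all values on a. *)
Lemma rank_two i0 m : i0 \in s -> p i0 = 1 -> q i0 = 0 -> (0 < m i0)%N ->
  exists (u w : S * S) (d1 d e : nat),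
  [/\ [/\ pairform d1 u, pairform d w, u <> (0, 0), w <> (0, 0)
        & (e + d + m i0 = \sum_(i <- s) m i)%N],
      logder2 m (lform a * u.1, lform a * u.2) /\ logder2 m w,
      forall h, logder2 m h -> exists x y,
         h.1 = x * (lform a * u.1) + y * w.1 /\ h.2 = x * (lform a * u.2) + y * w.2,
      (forall x y, x * (lform a * u.1) + y * w.1 = 0 -> x * (lform a * u.2) + y * w.2 = 0 ->
         x = 0 /\ y = 0) /\ divides (lform a) w.1
    & (exists c k, c != 0 /\ w.2 = c%:MP * lform b ^+ d + lform a * k) /\
      forall h, logder2 (fun i => m i - (i == i0))%N h ->
        exists x k, h.1 = lform a ^+ (m i0).-1 * (x * lform b ^+ e + lform a * k)].
Proof.
move=> si p1 q0 mi0; pose m' i := (m i - (i == i0))%N.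
have mE : raised_mult i0 m' =1 m.
  by move=> i; rewrite /raised_mult /m'; have [->|] := eqVneq i i0; rewrite ?subn0 ?addn0 // subnK.
have eai : ai i0 = a by rewrite /ai p1 q0 scale1r scale0r addr0.
have apE v : pair_eval i0 v = v.1 by rewrite /pair_eval p1 q0 mpolyC1 mpolyC0 mul1r mul0r addr0.
have [d10 [d20 [u' [w' pb0]]]] := prebasis_exists m'.
have [] := prebasis_prepare (b' := b) si _ _ _ _ pb0.
- by rewrite eai.
- by exists 0, 1; rewrite scale0r add0r scale1r.
- by exists 1, 0; rewrite eai scale1r scale0r addr0.
- by exists 0, 1; rewrite scale0r add0r scale1r.
move=> d1 [d2 [u [w [c [e [k [pb Dw c0 ue eE]]]]]]].
have la0 : lform a != 0 by rewrite lform_eq0.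
have [[U W] [Du Dw'] [c1 c10 det1] sum1] := pb.
have pb2 := prebasis_raised si pb Dw.
rewrite !eai in pb2; have [_ [Dau Dw2] [c2 c20 det2E] sum2] := pb2.
rewrite apE eai in ue.
have Q0 := Qpoly_neq0 arrA.
have wa1 : divides (lform a) w.1.
  have := Dw i0 si; rewrite apE eai /raised_mult eqxx addn1 exprS.
  by apply: divides_trans; apply/divides_mulr/divides_refl.
have E m1 m2 v : m1 =1 m2 -> logder2 m1 v -> logder2 m2 v.
  by move=> m12 D i i_s; rewrite -m12; auto.
have spanm h : logder2 m h -> exists x y,
   h.1 = x * (lform a * u.1) + y * w.1 /\ h.2 = x * (lform a * u.2) + y * w.2.
  by move=> Dh; apply: (cramer2 Dau Dw2 c20 det2E); apply: E Dh => i; rewrite mE.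
exists u, w, d1, d2, e; split=> //.
- split=> //.
  + move=> u0; have : c1%:MP * Qpoly s ai m' != 0 by rewrite mulf_neq0 ?mpolyC_eq0 ?Q0.
    by rewrite -det1 u0 /det2 /= ?mul0r ?mulr0 subr0 eqxx.
  + move=> w0; have : c1%:MP * Qpoly s ai m' != 0 by rewrite mulf_neq0 ?mpolyC_eq0 ?Q0.
    by rewrite -det1 w0 /det2 /= ?mul0r ?mulr0 subr0 eqxx.
  + have -> : (\sum_(i <- s) m i = d1.+1 + d2)%N.
      by rewrite sum2; apply: eq_bigr => i _; rewrite mE.
    by rewrite -eE /m' eqxx; lia.
- by split; apply: E mE _.
- split=> // x y h1 h2.
  have d0 : det2 (lform a * u.1, lform a * u.2) w != 0.
    by rewrite det2E mulf_neq0 ?mpolyC_eq0.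
  split; apply: (mulIf d0); rewrite mul0r.
    transitivity ((x * (lform a * u.1) + y * w.1) * w.2 -
        (x * (lform a * u.2) + y * w.2) * w.1); first by rewrite /det2 /=; ring.
    by rewrite h1 h2; ring.
  transitivity ((lform a * u.1) * (x * (lform a * u.2) + y * w.2) -
        (lform a * u.2) * (x * (lform a * u.1) + y * w.1)); first by rewrite /det2 /=; ring.
  by rewrite h1 h2; ring.
split.
  (* If c3 were zero, a would divide both entries of w and w / a would satisfy the lowered
     conditions; then det(u, w) = a det(u, w / a) would make a divide a nonzero constant. *)
  have [_ W2] := W; have [c3 [k3 [w2E _]]] := binform_lead W2.
  exists c3, k3; split=> //; apply/eqP => c30.
  have [g1 w1g] := wa1.
  have w2g : w.2 = lform a * k3 by rewrite w2E c30 mpolyC0 mul0r add0r.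
  have Dg : logder2 m' (g1, k3).
    move=> i i_s; have := Dw i i_s.
    have -> : pair_eval i w = lform a * pair_eval i (g1, k3).
      by rewrite /pair_eval w1g w2g /=; ring.
    rewrite /raised_mult; have [->|ii0] := eqVneq i i0.
      by rewrite eai addn1 exprS => /(divides_cancel la0).
    rewrite addn0; apply: prime_exp.
    - by apply: lform_prime; have [_ + _] := arrA; apply.
    - by rewrite lform_eq0; have [_ + _] := arrA; apply.
    - by rewrite -eai; have [_ _ +] := arrA; apply.
  have := Qpoly_divides_det2 Du Dg => -[z hz].
  have : det2 u w = lform a * det2 u (g1, k3) by rewrite /det2 w1g w2g /=; ring.
  rewrite det1 hz => /esym; rewrite mulrCA mulrC => /(mulIf (Q0 m')) h.
  have : divides (lform a) (c1%:MP : S) by exists z; rewrite h.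
  by move=> /(lform_dividesC a0)/eqP; rewrite (negPf c10).
move=> h Dh; have [x [y [-> _]]] := cramer2 Du Dw' c10 det1 Dh.
have [g1 w1g] : divides (lform a ^+ (m i0)) w.1.
  by have := Dw i0 si; rewrite apE eai mE.
exists (x * c%:MP), (x * k + y * g1).
rewrite ue w1g /m' eqxx subn1 -{2}(prednK mi0) exprS; ring.
Qed.

End RankTwo.

(** * Coordinates *)

Section Coordinates.
Variables (K : fieldType) (V : vectType K).
Local Notation n := (\dim (fullv : {vspace V})).
Local Notation S := {mpoly K[n]}.
Local Notation bas := (vbasis (fullv : {vspace V})).
Implicit Types (phi psi : 'Hom(V, K^o)) (H X : {vspace V}) (v : V).

Definition form_coef phi : 'cV[K]_n := \col_i phi bas`_i.
Definition vec_coord v : 'rV[K]_n := \row_i coord bas i v.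

Lemma vec_coord_form v phi : (vec_coord v *m form_coef phi) 0 0 = phi v.
Proof.
rewrite mxE {2}(coord_vbasis (memvf v)) linear_sum; apply: eq_bigr => i _.
by rewrite !mxE linearZ.
Qed.

Lemma vec_coord_bas (i : 'I_n) : vec_coord bas`_i = delta_mx 0 i.
Proof.
apply/rowP => j; rewrite !mxE eqxx /= coord_free ?(basis_free (vbasisP _)) //.
by rewrite eq_sym.
Qed.

Lemma vec_coordZ c v : vec_coord (c *: v) = c *: vec_coord v.
Proof. by apply/rowP => j; rewrite !mxE linearZ. Qed.

Lemma vec_coordB v v' : vec_coord (v - v') = vec_coord v - vec_coord v'.
Proof. by apply/rowP => j; rewrite !mxE linearB. Qed.

Lemma vec_coord_sum (I : finType) (F : I -> V) : vec_coord (\sum_i F i) = \sum_i vec_coord (F i).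
Proof. by apply/rowP => j; rewrite summxE !mxE linear_sum; apply: eq_bigr => i _; rewrite mxE. Qed.

Lemma form_coef_inj phi psi : form_coef phi = form_coef psi -> phi = psi.
Proof. by move=> e; apply/lfunP => v; rewrite -!vec_coord_form e. Qed.

Lemma form_coefZ c phi : form_coef (c *: phi) = c *: form_coef phi.
Proof. by apply/colP => i; rewrite !mxE scale_lfunE. Qed.

Lemma form_polyE phi : form_poly phi = lform (form_coef phi).
Proof. by apply: eq_bigr => i _; rewrite mxE. Qed.

Lemma der_applyE theta phi : der_apply theta (form_poly phi) = der_eval theta (form_coef phi).
Proof.
rewrite /der_eval mxE; apply: eq_bigr => i _; congr (_ * _).
rewrite mxE form_polyE lformE linear_sum (bigD1 i) //= big1 => [|j ji].
  rewrite linearZ /= mderivX mnmE eqxx scale1r addr0.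
  rewrite (_ : (U_(i) - U_(i))%MM = 0%MM) ?mpolyX0 -?mul_mpolyC ?mulr1 //.
  by apply/mnmP => j; rewrite !mnmE subnn.
by rewrite linearZ /= mderivX mnmE (negPf ji) scale0r scaler0.
Qed.

Lemma der_alongE v : der_along v = map_mx (@mpolyC n K) (vec_coord v).
Proof. by apply/rowP => j; rewrite !mxE. Qed.

Lemma der_eval_along v phi : der_eval (der_along v) (form_coef phi) = (phi v)%:MP.
Proof. by rewrite der_alongE der_eval_const vec_coord_form. Qed.

Lemma vanishing_proportional phi psi : (lker phi <= lker psi)%VS -> exists c, psi = c *: phi.
Proof.
move=> sub; have [e|phi0] := eqVneq phi 0.
  exists 0; rewrite e scaler0; apply/lfunP => v; rewrite zero_lfunE.
  by apply/eqP; rewrite -memv_ker; apply: (subvP sub); rewrite e memv_ker zero_lfunE.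
have [v pv] : exists v, phi v != 0.
  have [v vp|h] := pickP (fun i : 'I_n => phi bas`_i != 0); first by exists bas`_v.
  case/eqP: phi0; apply: form_coef_inj; apply/colP => i; rewrite !mxE zero_lfunE.
  by apply/eqP; have := h i; rewrite /= => /negbFE.
exists (psi v / phi v); apply/lfunP => x; rewrite scale_lfunE.
have : x - (phi x / phi v) *: v \in lker psi.
  by apply: (subvP sub); rewrite memv_ker linearB linearZ /= [_ *: _]divfK // subrr.
rewrite memv_ker linearB linearZ /= subr_eq0 => /eqP ->.
by rewrite /GRing.scale /=; ring.
Qed.

Lemma hyperplane_form_dim phi : phi != 0 -> is_hyperplane (lker phi).
Proof.
move=> phi0; rewrite /is_hyperplane -(limg_ker_dim phi fullv) capfv -addn1 eqn_add2l.
rewrite eqn_leq; apply/andP; split; last first.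
  by rewrite (leq_trans (dimvS (subvf _))) // dimvf /dim /=.
rewrite lt0n dimv_eq0; apply: contra phi0 => /eqP h; apply/eqP/lfunP => v.
by rewrite zero_lfunE; apply/eqP; rewrite -memv0 -h memv_img ?memvf.
Qed.

(** Gives [alpha] its specification: some coordinate of v - [projv H v] is a nonzero form vanishing
    on H. *)
Lemma hyperplane_form H : is_hyperplane H -> exists phi, lker phi = H.
Proof.
move=> /eqP hH.
have /subvPn[w _ wH] : ~~ (fullv <= H)%VS.
  by apply: contraTN isT => /dimvS; rewrite -hH ltnn.
have g0 : w - projv H w != 0.
  by apply: contraNneq wH => /eqP; rewrite subr_eq0 => /eqP ->; apply: memv_proj.
have [i ci] : exists i, coord bas i (w - projv H w) != 0.
  have [i ci|h] := pickP (fun i => coord bas i (w - projv H w) != 0); first by exists i.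
  case/eqP: g0; rewrite (coord_vbasis (memvf (w - _))) big1 // => i _.
  by have := h i; rewrite /= => /negbFE/eqP ->; rewrite scale0r.
pose phi : 'Hom(V, K^o) := (linfun (coord bas i : V -> K^o) \o (\1 - projv H))%VF.
have phiE v : phi v = coord bas i (v - projv H v).
  by rewrite comp_lfunE lfunE /= add_lfunE opp_lfunE id_lfunE.
have phi0 : phi != 0 by apply: contraNneq ci => e; rewrite -phiE e zero_lfunE.
exists phi; apply/eqP; rewrite eq_sym eqEdim; apply/andP; split.
  by apply/subvP => x xH; rewrite memv_ker phiE projv_id // subrr linear0.
by have /eqP := hyperplane_form_dim phi0; rewrite -hH => -[->].
Qed.

Lemma lker_alpha H : is_hyperplane H -> lker (alpha H) = H.
Proof. by move=> /hyperplane_form; apply: epsilon_spec. Qed.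

Definition alpha_coef H := form_coef (alpha H).

Lemma hyperplane_alpha_neq0 H : is_hyperplane H -> alpha H != 0.
Proof.
move=> hH; apply: contraTneq (hH) => e; rewrite -(lker_alpha hH) e /is_hyperplane.
rewrite (_ : lker 0 = fullv); first by rewrite -addn1 -[X in _ == X]addn0 eqn_add2l.
by apply/vspaceP => v; rewrite memvf memv_ker zero_lfunE eqxx.
Qed.

Lemma alpha_coef_neq0 H : is_hyperplane H -> alpha_coef H != 0.
Proof.
move=> /hyperplane_alpha_neq0; apply: contra => /eqP e; apply/eqP; apply: form_coef_inj.
by rewrite -/(alpha_coef H) e; apply/colP => i; rewrite !mxE zero_lfunE.
Qed.

Lemma hyperplane_sub H H' : is_hyperplane H -> is_hyperplane H' -> (H <= H')%VS -> H = H'.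
Proof.
move=> /eqP hH /eqP hH' sub; apply/eqP; rewrite eqEdim sub /=.
by rewrite -ltnS hH hH'.
Qed.

Lemma alpha_coef_coprime H H' : is_hyperplane H -> is_hyperplane H' -> H != H' ->
  ~ divides (lform (alpha_coef H)) (lform (alpha_coef H')).
Proof.
move=> hH hH' ne /(divides_lform (alpha_coef_neq0 hH))[c].
rewrite -form_coefZ => /form_coef_inj e; case/eqP: ne; apply: hyperplane_sub => //.
apply/subvP => v; rewrite -{1}(lker_alpha hH) -(lker_alpha hH') !memv_ker e scale_lfunE.
by move=> /eqP ->; rewrite scaler0.
Qed.

Definition hyperplanes (A : {fset {vspace V}}) := forall H, H \in A -> is_hyperplane H.

Lemma hyperplanes_arr A : hyperplanes A -> indep_forms (enum_fset A) alpha_coef.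
Proof.
move=> hA; split; first exact: fset_uniq; first by move=> H /hA; apply: alpha_coef_neq0.
by move=> H H' /hA hH /hA hH'; apply: alpha_coef_coprime.
Qed.

Lemma logderE A m theta : logder A m theta <-> logmod (enum_fset A) alpha_coef m theta.
Proof.
split=> D H HA; have := D H HA; rewrite der_applyE form_polyE.
  by move=> [g e]; exists g.
by move=> [g e]; exists g.
Qed.

Definition seqmx (b : seq 'rV[S]_n) : 'M[S]_(size b, n) := \matrix_i b`_i.

Lemma seqmx_sum b (f : 'I_(size b) -> S) :
  \sum_i f i *: b`_i = (\row_i f i) *m seqmx b.
Proof. by rewrite mulmx_sum_row; apply: eq_bigr => i _; rewrite rowK mxE. Qed.

Lemma module_basisP D b : is_module_basis D b <-> basis_mx D (seqmx b).
Proof.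
split=> -[bD spb fb]; split.
- by move=> i; rewrite rowK.
- by move=> theta /spb[f ->]; exists (\row_i f i); rewrite seqmx_sum.
- move=> f f0; apply/rowP => i; rewrite mxE; apply: fb.
  by rewrite seqmx_sum -f0; congr (_ *m _); apply/rowP => j; rewrite mxE.
- by move=> i; have := bD i; rewrite rowK.
- move=> theta /spb[f ->]; exists (f 0); rewrite seqmx_sum.
  by congr (_ *m _); apply/rowP => j; rewrite mxE.
- move=> f; rewrite seqmx_sum => /fb/rowP f0 i.
  by have := f0 i; rewrite !mxE.
Qed.

Lemma basis_mx_seq D r (M : 'M[S]_(r, n)) b : size b = r ->
  (forall i : 'I_r, b`_i = row i M) -> basis_mx D M -> is_module_basis D b.
Proof.
move=> sb; subst r => bM; rewrite module_basisP; suff -> : M = seqmx b by [].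
by apply/row_matrixP => i; rewrite rowK bM.
Qed.

Lemma basis_mx_ext r D D' (M : 'M[S]_(r, n)) : (forall theta, D theta <-> D' theta) ->
  basis_mx D M -> basis_mx D' M.
Proof.
move=> DD [H1 H2 H3]; split=> // [i|theta /DD/H2//].
exact/DD.
Qed.

Lemma is_freeP A m : hyperplanes A ->
  is_free A m <-> exists M : 'M[S]_n, basis_mx (logmod (enum_fset A) alpha_coef m) M.
Proof.
move=> hA; split=> [[b /module_basisP/(basis_mx_ext (logderE A m)) bb]|[M bM]].
  have sb := basis_size (hyperplanes_arr hA) bb.
  by move: (seqmx b) bb; rewrite sb => M bM; exists M.
exists [seq row i M | i <- enum 'I_n].
apply: (@basis_mx_seq _ _ M); first by rewrite size_map size_enum_ord.
  by move=> i; rewrite (nth_map i) ?size_enum_ord // nth_ord_enum.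
by apply: basis_mx_ext bM => theta; rewrite logderE.
Qed.

(** [homog_basis] supplies the witness that gives the [epsilon] in [exponents] its meaning. *)
Lemma exponents_spec A m : hyperplanes A -> is_free A m ->
  exists (M : 'M[S]_n) (d : 'I_n -> nat),
  [/\ basis_mx (logmod (enum_fset A) alpha_coef m) M, forall i j, M i j \is (d i).-homog
    & exponents A m = seq_mset [seq d i | i <- enum 'I_n]].
Proof.
move=> hA fA; have arrA := hyperplanes_arr hA.
have : is_exp A m (exponents A m).
  apply: epsilon_spec; have [B bB] := (is_freeP m hA).1 fA.
  have [M [d [bM M0 Md]]] := homog_basis arrA bB.
  exists (seq_mset [seq d i | i <- enum 'I_n]).
  exists [seq row i M | i <- enum 'I_n], [seq d i | i <- enum 'I_n]; split=> //.
    apply: (@basis_mx_seq _ _ M); first by rewrite size_map size_enum_ord.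
      by move=> i; rewrite (nth_map i) ?size_enum_ord // nth_ord_enum.
    by apply: basis_mx_ext bM => theta; rewrite logderE.
  elim: (enum 'I_n) => //= i r ->; rewrite andbT /der_homog M0 /=.
  by apply/forallP => j; rewrite mxE.
move=> [b [d [bb db ->]]].
have bb' := basis_mx_ext (logderE A m) ((module_basisP _ _).1 bb).
have sb := basis_size arrA bb'.
have sd : size d = n.
  by rewrite -sb; move: db; rewrite all2E => /andP[/eqP].
exists (\matrix_(i < n) b`_i), (fun i => nth 0%N d i); split.
- have : forall r (e : size b = r), basis_mx (logmod (enum_fset A) alpha_coef m) (\matrix_(i < r) b`_i).
    by move=> r e; subst r.
  exact.
- move=> i j; rewrite mxE; move: db; rewrite all2E => /andP[_ /(all_nthP (0%N, 0)) H].
  have := H i; rewrite size_zip sd sb minnn nth_zip ?sd ?sb //= => /(_ (ltn_ord i)).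
  by move=> /andP[_ /forallP].
- congr seq_mset; rewrite -[LHS](mkseq_nth 0%N) /mkseq sd -val_enum_ord -map_comp.
  exact: eq_map.
Qed.

End Coordinates.

(** * The Euler multiplicity *)

Section EulerMultiplicity.
Variables (K : fieldType) (V : vectType K).
Local Notation n := (\dim (fullv : {vspace V})).
Local Notation S := {mpoly K[n]}.
Local Notation bas := (vbasis (fullv : {vspace V})).
Implicit Types (phi psi : 'Hom(V, K^o)) (H X : {vspace V}) (v : V).

(** Coefficients indexed by [nat] instead of the ordinals of [size b] let the first two elements of
    a basis be split off. *)
Lemma module_basis_nat (D : 'rV[S]_n -> Prop) b :
  is_module_basis D b <->
  [/\ forall i, (i < size b)%N -> D b`_i,
      forall theta, D theta -> exists g : nat -> S, theta = \sum_(i < size b) g i *: b`_i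
    & forall g : nat -> S, \sum_(i < size b) g i *: b`_i = 0 ->
        forall i, (i < size b)%N -> g i = 0].
Proof.
pose ext (f : 'I_(size b) -> S) k := oapp f 0 (insub k).
have extE f (i : 'I_(size b)) : ext f i = f i by rewrite /ext valK.
split=> -[bD spb fb]; split.
- by move=> i ib; apply: (bD (Ordinal ib)).
- move=> theta /spb[f ->]; exists (ext f); apply: eq_bigr => i _; by rewrite extE.
- by move=> g /fb g0 i ib; apply: (g0 (Ordinal ib)).
- by move=> i; apply: bD.
- by move=> theta /spb[g ->]; exists (fun i => g i).
- move=> f f0 i; rewrite -extE; apply: fb => //; rewrite -[RHS]f0.
  by apply: eq_bigr => j _; rewrite extE.
Qed.

Lemma der_along_basis (e : seq V) : basis_of fullv e ->
  is_module_basis (fun _ => True) [seq der_along v | v <- e].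
Proof.
move=> be; pose r := size e; have be' : basis_of fullv (in_tuple e) := be.
pose Me : 'M[K]_(r, n) := \matrix_i vec_coord e`_i.
pose N : 'M[K]_(n, r) := \matrix_(i, j) coord (in_tuple e) j bas`_i.
have NM : N *m Me = 1%:M.
  apply/row_matrixP => i; rewrite row_mul row1 -vec_coord_bas.
  rewrite [in RHS](coord_basis be' (memvf bas`_i)).
  rewrite vec_coord_sum mulmx_sum_row; apply: eq_bigr => j _.
  by rewrite rowK vec_coordZ !mxE.
have MN : Me *m N = 1%:M.
  apply/matrixP => k j; rewrite !mxE -(coord_free _ _ (basis_free be')) /=.
  rewrite [in RHS](coord_vbasis (memvf e`_k)) linear_sum; apply: eq_bigr => i _.
  by rewrite !mxE linearZ.
apply: (@basis_mx_seq _ _ _ r (map_mx (@mpolyC n K) Me)); first by rewrite size_map.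
  move=> i; rewrite (nth_map 0) // der_alongE.
  by apply/rowP => j; rewrite !mxE.
split=> // [theta _|f f0].
  by exists (theta *m map_mx (@mpolyC n K) N); rewrite -mulmxA -map_mxM NM map_mx1 mulmx1.
by rewrite -[f]mulmx1 -(map_mx1 (@mpolyC n K)) -MN map_mxM mulmxA f0 mul0mx.
Qed.

Lemma hyperplane_dual_vector H H' : is_hyperplane H -> is_hyperplane H' -> H != H' ->
  exists v, alpha H v = 1 /\ alpha H' v = 0.
Proof.
move=> hH hH' ne.
have /subvPn[v vH' vH] : ~~ (H' <= H)%VS.
  by apply: contra ne => /(hyperplane_sub hH' hH) ->.
have v0 : alpha H v != 0 by rewrite -memv_ker lker_alpha.
exists ((alpha H v)^-1 *: v); split; rewrite linearZ /=; first by rewrite [_ *: _]mulVf.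
by move: vH'; rewrite -{1}(lker_alpha hH') memv_ker => /eqP ->; rewrite scaler0.
Qed.

Lemma hyperplane_cap_basis H H' e1 e2 : is_hyperplane H -> is_hyperplane H' -> H != H' ->
  alpha H e1 = 1 -> alpha H' e1 = 0 -> alpha H e2 = 0 -> alpha H' e2 = 1 ->
  (forall v, v - alpha H v *: e1 - alpha H' v *: e2 \in (H :&: H')%VS) /\
  basis_of fullv [:: e1, e2 & vbasis (H :&: H')%VS].
Proof.
move=> hH hH' ne a1 b1 a2 b2.
have dec v : v - alpha H v *: e1 - alpha H' v *: e2 \in (H :&: H')%VS.
  rewrite memv_cap -{2}(lker_alpha hH) -{3}(lker_alpha hH') !memv_ker !linearB !linearZ /=.
  rewrite a1 a2 b1 b2 oppr0 /GRing.scale /= !mulrN1 !mulr0 !addr0 !subrr.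
  by rewrite eqxx.
split=> //; rewrite basisEdim; apply/andP; split.
  apply/subvP => v _; rewrite !span_cons (span_basis (vbasisP _)).
  rewrite -[v](subrK (alpha H v *: e1)) addrC.
  rewrite memv_add ?memvZ ?memv_line //.
  rewrite -[X in X \in _](subrK (alpha H' v *: e2)) addrC.
  by rewrite memv_add ?memvZ ?memv_line.
rewrite /= size_tuple; have := dimv_sum_cap H H'.
have : (\dim H < \dim (H + H'))%N.
  rewrite ltn_neqAle (dimv_leqif_eq (addvSl H H')) dimvS ?addvSl // andbT.
  apply: contra ne => /eqP e; apply/eqP/esym/hyperplane_sub => //.
  by rewrite e addvSr.
by move: hH hH' => /eqP hH /eqP hH'; rewrite -hH in hH' *; lia.
Qed.

Lemma in_alpha_derP H theta : in_alpha_der H theta ->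
  forall phi, divides (lform (alpha_coef H)) (der_eval theta (form_coef phi)).
Proof.
move=> [eta ->] phi; exists (der_eval eta (form_coef phi)).
by rewrite der_evalZ form_polyE.
Qed.

Variables (A : {fset {vspace V}}) (m : {vspace V} -> nat) (H0 U : {vspace V}).
Hypotheses (Am : is_multiarrangement A m) (AH0 : H0 \in A) (AU : U \in A) (UH0 : U != H0).

Let X := (H0 :&: U)%VS.
Let AX := localization A X.
Let hA : hyperplanes A. Proof. by move=> H /Am[]. Qed.

Lemma localizationP H : H \in AX -> [/\ H \in A, is_hyperplane H & (X <= H)%VS].
Proof. by rewrite !inE /= => /andP[HA XH]; rewrite HA XH (hA HA). Qed.

(* This makes deg theta_X independent of the basis: it is the degree of a
   generator of a principal ideal modulo alpha_0. *)
Lemma euler_mult_principal d : is_euler_mult A m H0 X d ->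
  exists2 theta, logder AX m theta /\ der_eval theta (alpha_coef U) \is d.-homog &
    forall eta, logder AX m eta -> exists x k,
      der_eval eta (alpha_coef U) = x * der_eval theta (alpha_coef U) + lform (alpha_coef H0) * k.
Proof.
move=> [e [theta [psi [q [[be Xe] bb [ht hp] _ ps0]]]]].
have [bD spb _] := (module_basis_nat _ _).1 bb.
exists theta.
  split; first exact: (bD 0%N).
  move: ht => /andP[_ /forallP ht].
  rewrite /der_eval mxE; apply: rpred_sum => i _.
  by rewrite mxE mulrC mul_mpolyC; apply/rpredZ/ht.
move=> eta /spb[g ->]; have [k pk] := in_alpha_derP ps0 (alpha U).
exists (g 0%N), (g 1%N * k); rewrite der_eval_sum /= big_ord_recl big_ord_recl /= !der_evalZ.
rewrite -/(alpha_coef U) in pk; rewrite pk big1 ?addr0; first by rewrite mulrCA.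
move=> i _; rewrite der_evalZ (nth_map 0) ?der_eval_along; last first.
  by have := ltn_ord i; rewrite /= [X in (_ < X)%N]size_map.
rewrite (_ : alpha U _ = 0) ?mpolyC0 ?mulr0 //.
apply/eqP; rewrite -memv_ker lker_alpha ?hA //.
apply: (subvP (capvSr H0 U)); rewrite -/X Xe; apply: memv_span; apply: mem_nth.
by have := ltn_ord i; rewrite /= [X in (_ < X)%N]size_map.
Qed.

(** Carries [rank_two] over to A_X: its forms are combinations of [alpha H0] and [alpha U], and
    modulo directions along X a derivation is given by its values on these two. The first half makes
    restrictions to H_0 land in D(A'', m^* ); the second yields the factor of B at X. *)
Lemma euler_mult_spec (d := euler_mult A m H0 X) :
  (forall eta, logder A m eta -> exists x k,
      der_eval eta (alpha_coef U) = x * lform (alpha_coef U) ^+ d + lform (alpha_coef H0) * k) /\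
  exists2 e, (e + d + m H0 = \sum_(H <- AX) m H)%N &
    forall eta, logmod (enum_fset A) (@alpha_coef K V) (fun H => m H - (H == H0))%N eta ->
      exists x k,
      der_eval eta (alpha_coef H0) = lform (alpha_coef H0) ^+ (m H0).-1 *
         (x * lform (alpha_coef U) ^+ e + lform (alpha_coef H0) * k).
Proof.
have hH0 := hA AH0; have hU := hA AU.
have H0U : H0 != U by rewrite eq_sym.
have [e1 [a1 b1]] := hyperplane_dual_vector hH0 hU H0U.
have [e2 [b2 a2]] := hyperplane_dual_vector hU hH0 UH0.
have [dec be] := hyperplane_cap_basis hH0 hU H0U a1 b1 a2 b2.
(* Coefficients of [alpha H] with respect to [alpha H0] and [alpha U], read off at the dual vectors
   e1 and e2. *)
pose p H := alpha H e1 : K; pose q H := alpha H e2 : K.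
have afE H : H \in AX -> p H *: alpha_coef H0 + q H *: alpha_coef U = alpha_coef H.
  move=> /localizationP[HA hH XH]; apply/colP => i; rewrite !mxE.
  have := subvP XH _ (dec bas`_i); rewrite -{1}(lker_alpha hH) memv_ker !linearB !linearZ /=.
  rewrite /GRing.scale /= !mulrN subr_eq0 subr_eq => /eqP ->.
  by rewrite /p /q; ring.
have sAX : {subset AX <= A} by move=> H /localizationP[].
have arrAX : indep_forms (enum_fset AX) (@alpha_coef K V) by apply: hyperplanes_arr => H /sAX/hA.
have arrAX' : indep_forms (enum_fset AX) (fun H => p H *: alpha_coef H0 + q H *: alpha_coef U).
  have [h1 h2 h3] := arrAX; split=> // [H sH|H H' sH sH']; first by rewrite afE ?h2.
  by rewrite !afE //; apply: h3.
pose pr eta : S * S := (der_eval eta (alpha_coef H0), der_eval eta (alpha_coef U)).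
have prE mm eta : logmod (enum_fset AX) (@alpha_coef K V) mm eta <->
    logder2 (enum_fset AX) (alpha_coef H0) (alpha_coef U) p q mm (pr eta).
  have E H : H \in AX -> pair_eval p q H (pr eta) = der_eval eta (alpha_coef H).
    by move=> HX; rewrite -(afE H HX) der_eval_Dr !der_eval_Zr.
  by split=> h H HX; have := h H HX; rewrite E ?afE.
have H0X : H0 \in AX by rewrite !inE /= AH0 capvSl.
have p1 : p H0 = 1 by [].
have q0 : q H0 = 0 by [].
have m0 : (0 < m H0)%N by case: (Am AH0).
have ndab := alpha_coef_coprime hH0 hU H0U.
have af0 := alpha_coef_neq0 hH0.
have [u [w [d1 [d' [e [[Uf Wf u0 w0 sum] [Du Dw] spuw [fruw w1] [[c [k [c0 w2]]] F2]]]]]]] :=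
  rank_two af0 ndab arrAX' H0X p1 q0 m0.
pose bx := vbasis (H0 :&: U)%VS.
pose der2 (f g : S) : 'rV[S]_n := f *: der_along e1 + g *: der_along e2.
have pr2 f g : pr (der2 f g) = (f, g).
  rewrite /pr !der_evalD !der_evalZ !der_eval_along a1 b1 a2 b2 mpolyC0 mpolyC1.
  by rewrite !mulr1 !mulr0 addr0 add0r.
have der2_homog r f g : f \is r.-homog -> g \is r.-homog -> (f, g) <> (0, 0) ->
    der_homog r (der2 f g).
  move=> fr gr fg0; apply/andP; split.
    by apply/eqP => h; apply: fg0; rewrite -pr2 h /pr !der_eval0.
  apply/forallP => i; rewrite !mxE ![_ * _%:MP]mulrC !mul_mpolyC.
  by apply: rpredD; apply: rpredZ.
have along0 v : v \in X ->
    der_eval (der_along v) (alpha_coef H0) = 0 /\ der_eval (der_along v) (alpha_coef U) = 0.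
  rewrite memv_cap -{1}(lker_alpha hH0) -{1}(lker_alpha hU) !memv_ker.
  by move=> /andP[/eqP h1 /eqP h2]; rewrite !der_eval_along h1 h2 mpolyC0.
have bxX i : (i < size bx)%N -> bx`_i \in X.
  by move=> ib; apply: vbasis_mem; apply: mem_nth.
have tailpr r (g : 'I_r -> S) (j : 'I_r -> nat) : (forall i, (j i < size bx)%N) ->
    pr (\sum_i g i *: [seq der_along v | v <- bx]`_(j i)) = (0, 0).
  move=> jb; rewrite /pr !der_eval_sum !big1 // => i _.
    by rewrite der_evalZ (nth_map 0) //; have [_ ->] := along0 _ (bxX _ (jb i)); rewrite mulr0.
  by rewrite der_evalZ (nth_map 0) //; have [-> _] := along0 _ (bxX _ (jb i)); rewrite mulr0.
have prD x y : pr (x + y) = ((pr x).1 + (pr y).1, (pr x).2 + (pr y).2) by rewrite /pr !der_evalD.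
set al := lform (alpha_coef H0).
have w2nd : ~ divides al w.2.
  rewrite w2 => h; have : divides al (c%:MP * lform (alpha_coef U) ^+ d').
    rewrite -[X in divides _ X](addrK (al * k)); apply: dividesB => //.
    by exists k.
  move=> /(divides_unit (mpolyC_unit _ c0)).
  by move=> /(prime_divides_exp (lform_prime af0) (lform_ndivides1 af0)).
pose theta := der2 w.1 w.2; pose psi := der2 (al * u.1) (al * u.2).
have [dt1 dt2] : der_eval theta (alpha_coef H0) = w.1 /\ der_eval theta (alpha_coef U) = w.2.
  by have [] := pr2 w.1 w.2.
have [dp1 dp2] : der_eval psi (alpha_coef H0) = al * u.1 /\ der_eval psi (alpha_coef U) = al * u.2.
  by have [] := pr2 (al * u.1) (al * u.2).
have [_ spe fre] := (module_basis_nat _ _).1 (der_along_basis be).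
have em' : is_euler_mult A m H0 X d'.
  exists [:: e1, e2 & bx], theta, psi, d1.+1; split.
  - by split=> //=; rewrite drop0 (span_basis (vbasisP _)).
  - rewrite /= drop0; apply/module_basis_nat; split.
    + move=> [_|[_|i ib]]; rewrite logderE prE /=.
      * by rewrite pr2 -surjective_pairing.
      * by rewrite pr2.
      have {}ib : (i < size bx)%N by rewrite /= size_map in ib.
      have [h1 h2] := along0 _ (bxX i ib).
      rewrite (nth_map 0) // => H HX; rewrite /pair_eval /pr h1 h2.
      by rewrite !mulr0 addr0; apply: divides0.
    + move=> eta /logderE/prE/spuw[x [y [h1 h2]]].
      (* Without its theta and psi parts, eta has value zero on both forms, so its components along
         e1 and e2 vanish and only directions along X remain. *)
      have [g eg] := spe (eta - y *: theta - x *: psi) Logic.I.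
      have : pr (eta - y *: theta - x *: psi) = (0, 0).
        rewrite -scaleNr -scaleNr !prD /= !der_evalZ.
        rewrite dt1 dt2 dp1 dp2.
        by rewrite /= in h1 h2 *; rewrite h1 h2; congr pair; rewrite -?/al; ring.
      rewrite eg /= big_ord_recl big_ord_recl /= addrA prD tailpr => [|i]; last first.
        by have := ltn_ord i; rewrite [X in (_ < X)%N]size_map.
      rewrite -/(der2 _ _) pr2 /= !addr0 => -[g0 g1].
      exists (fun i => if i is i'.+2 then g i else if i is 1%N then x else y).
      rewrite /= big_ord_recl big_ord_recl /= addrA.
      move: eg; rewrite /= big_ord_recl big_ord_recl /= g0 g1 !scale0r !add0r => eg.
      rewrite [X in _ = _ + X](_ : _ = eta - y *: theta - x *: psi); last by rewrite eg.
      by rewrite [RHS]addrC -[X in _ = X + _]addrA -opprD subrK.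
    + move=> g; rewrite big_ord_recl big_ord_recl /= addrA => sum0.
      have : pr (g 0%N *: theta + g 1%N *: psi + \sum_(i < size [seq der_along v | v <- bx])
          g i.+2 *: [seq der_along v | v <- bx]`_i) = (0, 0).
        by rewrite sum0 /pr !der_eval0.
      rewrite prD tailpr => [|i]; last by have := ltn_ord i; rewrite [X in (_ < X)%N]size_map.
      rewrite prD /= !addr0 !der_evalZ.
      rewrite dt1 dt2 dp1 dp2 => s12.
      have /= s1 := congr1 fst s12; have /= s2 := congr1 snd s12.
      rewrite addrC in s1; rewrite addrC in s2.
      have [g1 g0] := fruw _ _ s1 s2.
      have := fre (fun i => if i is i'.+2 then g i else 0).
      rewrite /= big_ord_recl big_ord_recl /= !scale0r !add0r.
      rewrite g0 g1 !scale0r !add0r in sum0; rewrite sum0 => /(_ erefl) gz.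
      by move=> [|[|i]] // ib; have := gz i.+2 ib.
  - split.
      by apply: der2_homog; [apply: binform_homog Wf.1 | apply: binform_homog Wf.2 |
        rewrite -surjective_pairing].
    apply: der2_homog.
    + by apply: (@dhomogM _ _ _ 1); [apply: lform_homog | apply: binform_homog Uf.1].
    + by apply: (@dhomogM _ _ _ 1); [apply: lform_homog | apply: binform_homog Uf.2].
    have al0 : al != 0 by rewrite lform_eq0.
    move=> u12; have /eqP := congr1 fst u12; have /eqP := congr1 snd u12.
    rewrite /= !mulf_eq0 (negPf al0) /= => /eqP h2 /eqP h1.
    by apply: u0; rewrite [u]surjective_pairing h1 h2.
  - move=> /in_alpha_derP/(_ (alpha U)).
    by rewrite -/(alpha_coef U) dt2; apply: w2nd.
  - exists (der2 u.1 u.2); rewrite form_polyE -/(alpha_coef H0) -/al.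
    by rewrite /psi /der2 scalerDr !scalerA.
have [theta' [Dtheta' theta'd] prin] := euler_mult_principal
  (epsilon_spec (inhabits 0%N) (is_euler_mult A m H0 X) (ex_intro _ d' em')).
rewrite -/(euler_mult A m H0 X) -/d in theta'd.
(* Restricted to H_0, the values of [theta] and of the chosen [theta'] on [alpha U] divide each
   other, so they differ by a nonzero constant. *)
have dd : d' = d.
  have Dth : logder AX m theta by apply/logderE/prE; rewrite pr2 -surjective_pairing.
  have [x [k1 e1']] := prin theta Dth.
  rewrite dt2 in e1'.
  have [x' [y' [_ e2']]] := spuw _ ((prE m theta').1 ((logderE AX m theta').1 Dtheta')).
  rewrite /= in e2'.
  have [v va] := exists_dual_vector af0.
  pose tau := lsub (1%:M - alpha_coef H0 *m v).
  have tal : tau al = 0 by apply/(divides_lformP _ va)/divides_refl.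
  have tw2 : tau w.2 != 0.
    by apply/eqP => /(divides_lformP _ va); apply: w2nd.
  have t1 : tau w.2 = tau x * tau (der_eval theta' (alpha_coef U)).
    by rewrite e1' /tau rmorphD !rmorphM /= -/tau -/al tal mul0r addr0.
  have t2 : tau (der_eval theta' (alpha_coef U)) = tau y' * tau w.2.
    by rewrite e2' /tau rmorphD !rmorphM /= -/tau -/al tal mul0r mulr0 add0r.
  have xy : tau x * tau y' = 1.
    by apply: (mulIf tw2); rewrite mul1r -mulrA -t2 -t1.
  have /unit_mpolyP[cx cx0 xC] : divides (tau x) 1 by exists (tau y').
  have h1 : tau w.2 \is d'.-homog by apply/lsub_homog/binform_homog/Wf.2.
  apply: (dhomog_uniq tw2 h1); rewrite t1 xC mul_mpolyC; apply: rpredZ.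
  exact: lsub_homog.
split.
  move=> eta Deta.
  have Deta' : logmod (enum_fset AX) (@alpha_coef K V) m eta.
    by move=> H HX; apply: ((logderE A m eta).1 Deta) (sAX _ HX).
  have [x [y [_ /= ->]]] := spuw _ ((prE m eta).1 Deta').
  exists (y * c%:MP), (x * u.2 + y * k); rewrite w2 -dd -?/al; ring.
exists e; first by rewrite -dd.
move=> eta Deta.
have Deta' : logmod (enum_fset AX) (@alpha_coef K V) (fun H => m H - (H == H0))%N eta.
  by move=> H HX; apply: Deta (sAX _ HX).
exact: F2 _ ((prE _ eta).1 Deta').
Qed.

End EulerMultiplicity.

(** * Restriction to a hyperplane *)

Section HomogeneousCoordinates.
Variables (K : fieldType) (n : nat).
Local Notation S := {mpoly K[n]}.

(** Each coefficient is replaced by its component of degree p - d j. The test on d j is essential: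
    truncated subtraction would keep the constant term where the degree should be negative. *)
Lemma homog_basis_coords r (D : 'rV[S]_n -> Prop) (N : 'M[S]_(r, n)) (d : 'I_r -> nat) p eta :
  basis_mx D N -> (forall i j, N i j \is (d i).-homog) ->
  D eta -> (forall j, eta 0 j \is p.-homog) ->
  exists2 f : 'rV_r, eta = f *m N & forall j, (p < d j)%N -> f 0 j = 0.
Proof.
move=> [_ spN _] Nd /spN[f ef] etap.
exists (\row_j if (d j <= p)%N then pihomog mdeg (p - d j) (f 0 j) else 0); last first.
  by move=> j pd; rewrite mxE leqNgt pd.
apply/rowP => k; rewrite -(pihomog_dE (etap k)) ef !mxE raddf_sum /=.
apply: eq_bigr => j _; rewrite mxE mulrC (pihomogM_homog _ _ (Nd j k)).
by case: ifP; rewrite ?mul0r // mulrC.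
Qed.

(** Yields a relation among the P-rows alone, with a matching instead of a count. Each row outside P
    is replaced by the unit vector of its own column k i - 1, where all P-rows vanish. The new
    matrix still has more rows than columns, and that column forces the coefficient of the replaced
    row to be zero. *)
Lemma dep_matrix_kernel (R : idomainType) nn n' (C : 'M[R]_(nn, n')) (P : pred 'I_nn)
    (k : 'I_nn -> nat) :
  (n' < nn)%N -> injective k -> (forall i, ~~ P i -> (0 < k i <= n')%N) ->
  (forall i i' (j : 'I_n'), P i -> ~~ P i' -> k i' = j.+1 -> C i j = 0) ->
  exists2 v : 'rV[R]_nn, v != 0 &
    (forall i, ~~ P i -> v 0 i = 0) /\
    forall j, \sum_i v 0 i * C i j = 0.
Proof.
move=> lt kinj kP CP.
pose C' : 'M[R]_(nn, n') := \matrix_(i, j) if P i then C i j else (k i == j.+1)%:R.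
have [v v0 vC] := row_dependent C' lt.
have vP i : ~~ P i -> v 0 i = 0.
  move=> Pi; have := kP i Pi; case ki : (k i) => [|j] //= jn.
  have /rowP/(_ (Ordinal jn)) := vC; rewrite !mxE (bigD1 i) //= mxE (negPf Pi) ki eqxx mulr1.
  rewrite big1 ?addr0 // => i' ne; rewrite mxE /=; case: ifP => Pi'.
    by rewrite (CP i' i) ?mulr0.
  by rewrite -ki (inj_eq kinj) (negPf ne) mulr0.
exists v => //; split=> // j.
have /rowP/(_ j) := vC; rewrite !mxE => sum0; rewrite -[RHS]sum0.
apply: eq_bigr => i _; rewrite mxE; case: ifP => // /negbT/vP ->.
by rewrite !mul0r.
Qed.

End HomogeneousCoordinates.

(** * Coordinates on the hyperplane and restriction of derivations *)

Section Restriction.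
Variables (K : fieldType) (V : vectType K) (H0 : {vspace V}).
Local Notation V0 := (subvs_of H0).
Local Notation n := (\dim (fullv : {vspace V})).
Local Notation n0 := (\dim (fullv : {vspace V0})).
Local Notation S := {mpoly K[n]}.
Local Notation S0 := {mpoly K[n0]}.
Local Notation bas := (vbasis (fullv : {vspace V})).
Local Notation bas0 := (vbasis (fullv : {vspace V0})).
Hypothesis hH0 : is_hyperplane H0.

Lemma dim_restriction : n0.+1 = n.
Proof. by have /eqP <- := hH0; rewrite dimvf. Qed.

Definition incl_mx : 'M[K]_(n0, n) := \matrix_j vec_coord (vsval bas0`_j).

Lemma incl_mx_form phi : incl_mx *m form_coef phi = form_coef (phi \o linfun (vsval : V0 -> V))%VF.
Proof.
apply/colP => j.
transitivity ((vec_coord (vsval bas0`_j) *m form_coef phi) 0 0); last first.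
  by rewrite vec_coord_form !mxE comp_lfunE lfunE.
by rewrite !mxE; apply: eq_bigr => i _; rewrite !mxE.
Qed.

Lemma incl_mx_alpha : incl_mx *m alpha_coef H0 = 0.
Proof.
rewrite incl_mx_form; apply/colP => j; rewrite !mxE comp_lfunE lfunE /=.
have : vsval bas0`_j \in lker (alpha H0) by rewrite lker_alpha // subvsP.
by rewrite memv_ker => /eqP.
Qed.

Lemma exists_retraction : exists (w : 'rV[K]_n) (G : 'M[K]_(n, n0)),
  [/\ w *m alpha_coef H0 = 1%:M, incl_mx *m G = 1%:M & G *m incl_mx = 1%:M - alpha_coef H0 *m w].
Proof.
have [w wa] := exists_dual_vector (alpha_coef_neq0 hH0).
pose G0 : 'M[K]_(n, n0) := \matrix_i vec_coord (vsproj H0 bas`_i).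
have rvG0 v : vec_coord v *m G0 = vec_coord (vsproj H0 v).
  rewrite mulmx_sum_row [in RHS](coord_vbasis (memvf v)) linear_sum vec_coord_sum.
  by apply: eq_bigr => i _; rewrite rowK linearZ vec_coordZ mxE.
have rvE x : vec_coord x *m incl_mx = vec_coord (vsval x).
  rewrite mulmx_sum_row [in RHS](coord_vbasis (memvf x)) linear_sum vec_coord_sum.
  by apply: eq_bigr => i _; rewrite rowK linearZ vec_coordZ mxE.
have [v0 ev0] : exists v, vec_coord v = w.
  exists (\sum_i w 0 i *: bas`_i); apply/rowP => i; rewrite mxE.
  by rewrite coord_sum_free // (basis_free (vbasisP _)).
(* [vsproj] projects along a complement of H0 unrelated to w, so vectors are first moved into H0
   along w. *)
exists w, ((1%:M - alpha_coef H0 *m w) *m G0); split=> //.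
  rewrite mulmxA mulmxBr mulmx1 mulmxA incl_mx_alpha mul0mx subr0.
  apply/row_matrixP => j; rewrite row_mul rowK rvG0 vsvalK vec_coord_bas.
  by rewrite row1.
rewrite -mulmxA; apply/row_matrixP => i.
rewrite row_mul.
have -> : row i (1%:M - alpha_coef H0 *m w) = vec_coord (bas`_i - alpha H0 bas`_i *: v0).
  rewrite linearB /= row1 vec_coordB vec_coord_bas vec_coordZ ev0; congr (_ - _).
  by apply/rowP => j; rewrite !mxE big_ord1 mxE.
rewrite mulmxA rvG0 rvE vsprojK //.
rewrite -{2}(lker_alpha hH0) memv_ker linearB linearZ /= -[alpha H0 v0]vec_coord_form ev0.
by rewrite -/(alpha_coef H0) wa mxE eqxx /GRing.scale /= mulr1 subrr.
Qed.

Lemma limg_vsval : limg (linfun (vsval : V0 -> V)) = H0.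
Proof.
apply/vspaceP => v; apply/idP/idP => [/memv_imgP[x _ ->]|vH].
  by rewrite lfunE subvsP.
by apply/memv_imgP; exists (vsproj H0 v); rewrite ?memvf // lfunE /= vsprojK.
Qed.

Lemma from_trace_on U : from_trace (trace_on H0 U) = (H0 :&: U)%VS.
Proof.
rewrite /from_trace /trace_on -lpreim_cap_limg limg_vsval capvC lpreimK //.
by rewrite limg_vsval capvSl.
Qed.

Lemma trace_on_lker U : is_hyperplane U ->
  trace_on H0 U = lker (alpha U \o linfun (vsval : V0 -> V))%VF.
Proof.
move=> hU; apply/vspaceP => x; rewrite -memv_preim memv_ker comp_lfunE.
by rewrite -{1}(lker_alpha hU) memv_ker.
Qed.

Lemma trace_on_hyperplane U : is_hyperplane U -> U != H0 -> is_hyperplane (trace_on H0 U).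
Proof.
move=> hU ne; rewrite trace_on_lker //; apply: hyperplane_form_dim.
apply: contra ne => /eqP e; apply/eqP/esym/hyperplane_sub => //; apply/subvP => v vH.
have : (alpha U \o linfun (vsval : V0 -> V))%VF (vsproj H0 v) = 0 by rewrite e zero_lfunE.
by rewrite comp_lfunE lfunE /= vsprojK // => /eqP; rewrite -memv_ker lker_alpha.
Qed.

(** The two forms on H_0 have the same kernel, but [alpha] of the trace is an independent choice,
    hence the constant c. *)
Lemma alpha_coef_trace_on U : is_hyperplane U -> U != H0 ->
  exists2 c, c != 0 & alpha_coef (trace_on H0 U) = c *: (incl_mx *m alpha_coef U).
Proof.
move=> hU ne; have hT := trace_on_hyperplane hU ne.
have [|c ec] := @vanishing_proportional _ _ (alpha U \o linfun (vsval : V0 -> V))%VF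
  (alpha (trace_on H0 U)); first by rewrite lker_alpha // trace_on_lker.
exists c; last by rewrite /alpha_coef ec form_coefZ incl_mx_form.
by apply: contraNneq (hyperplane_alpha_neq0 hT) => c0; rewrite ec c0 scale0r.
Qed.

Variables (w : 'rV[K]_n) (G : 'M[K]_(n, n0)).
Hypotheses (wa : w *m alpha_coef H0 = 1%:M) (EG : incl_mx *m G = 1%:M).
Hypothesis GE : G *m incl_mx = 1%:M - alpha_coef H0 *m w.

Local Notation rho := (lsub incl_mx).
Local Notation sigma := (lsub G).

Lemma rho_sigma f : rho (sigma f) = f.
Proof. by rewrite lsub_comp EG lsub1. Qed.

Lemma rho_eq0 f : rho f = 0 <-> divides (lform (alpha_coef H0)) f.
Proof.
rewrite (divides_lformP _ wa) -GE -lsub_comp; split=> [->|h]; first by rewrite rmorph0.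
by rewrite -[rho f]rho_sigma h rmorph0.
Qed.

(* Each row is a derivation of S; it is restricted to H0 and its values are
   projected to H0 along w, which changes nothing if it preserves alpha S. *)
Definition restrict_der r (M : 'M[S]_(r, n)) : 'M[S0]_(r, n0) :=
  map_mx rho M *m map_mx (@mpolyC n0 K) G.

Lemma restrict_der_mul r k (f : 'M[S]_(k, r)) (M : 'M[S]_(r, n)) :
  restrict_der (f *m M) = map_mx rho f *m restrict_der M.
Proof. by rewrite /restrict_der map_mxM mulmxA. Qed.

Lemma restrict_der_row r (M : 'M[S]_(r, n)) i : restrict_der (row i M) = row i (restrict_der M).
Proof. by rewrite /restrict_der row_mul map_row. Qed.

Lemma restrict_der_homog (theta : 'rV[S]_n) d : (forall j, theta 0 j \is d.-homog) ->
  forall j, restrict_der theta 0 j \is d.-homog.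
Proof.
move=> td j; rewrite mxE; apply: rpred_sum => i _; rewrite !mxE mulrC mul_mpolyC.
by apply/rpredZ/lsub_homog.
Qed.

Lemma rho_der_eval (theta : 'rV[S]_n) b :
  rho (der_eval theta b) = (map_mx rho theta *m map_mx (@mpolyC n0 K) b) 0 0.
Proof.
rewrite /der_eval !mxE rmorph_sum; apply: eq_bigr => i _.
by rewrite rmorphM !mxE /= lsubC.
Qed.

(** Projecting along w subtracts a multiple of theta(alpha_0) restricted to H_0, which vanishes
    here. *)
Lemma der_eval_restrict (theta : 'rV[S]_n) b :
  divides (lform (alpha_coef H0)) (der_eval theta (alpha_coef H0)) ->
  der_eval (restrict_der theta) (incl_mx *m b) = rho (der_eval theta b).
Proof.
move=> /rho_eq0; rewrite !rho_der_eval => t0.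
have z : map_mx rho theta *m map_mx (@mpolyC n0 K) (alpha_coef H0) = 0.
  by rewrite [LHS]mx11_scalar t0 raddf0.
rewrite /der_eval /restrict_der -mulmxA -map_mxM mulmxA GE mulmxBl mul1mx map_mxB mulmxBr.
by rewrite -mulmxA map_mxM [X in _ - X]mulmxA z mul0mx subr0.
Qed.

(** Evaluation on the coordinate forms shows that every entry of theta vanishes on H_0. *)
Lemma restrict_der_eq0 (theta : 'rV[S]_n) :
  divides (lform (alpha_coef H0)) (der_eval theta (alpha_coef H0)) ->
  restrict_der theta = 0 -> exists eta, theta = lform (alpha_coef H0) *: eta.
Proof.
move=> t0 r0.
have /fin_all_exists[g eg] : forall i, exists g, theta 0 i = lform (alpha_coef H0) * g.
  move=> i; apply/rho_eq0; have := der_eval_restrict (delta_mx i 0) t0.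
  rewrite r0 der_eval0 => /esym; rewrite /der_eval map_delta_mx.
  by rewrite -colE !mxE.
by exists (\row_i g i); apply/rowP => i; rewrite eg !mxE.
Qed.

End Restriction.

(** * The triple *)

Section Addition.
Variables (K : fieldType) (V : vectType K).
Variables (A : {fset {vspace V}}) (m : {vspace V} -> nat) (H0 : {vspace V}).
Local Notation V0 := (subvs_of H0).
Local Notation n := (\dim (fullv : {vspace V})).
Local Notation n0 := (\dim (fullv : {vspace V0})).
Local Notation S := {mpoly K[n]}.
Local Notation S0 := {mpoly K[n0]}.
Hypotheses (Am : is_multiarrangement A m) (AH0 : H0 \in A).

Local Notation D := (logmod (enum_fset A) (@alpha_coef K V)).
Local Notation A0 := (restriction A H0).
Local Notation mstar := (restriction_mult A m (H0 := H0)).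
Local Notation D0 := (logmod (enum_fset A0) (@alpha_coef K V0) mstar).
Local Notation al := (lform (alpha_coef H0)).

Let hA : hyperplanes A. Proof. by move=> H /Am[]. Qed.
Let hH0 : is_hyperplane H0. Proof. exact: hA. Qed.
Let m0 : (0 < m H0)%N. Proof. by have [] := Am AH0. Qed.
Let al0 : al != 0. Proof. by rewrite lform_eq0 alpha_coef_neq0. Qed.

(** Where the deletion removes H_0, it is kept here with multiplicity 0; that condition is void, so
    both cases of the deletion are treated alike. *)
Definition lowered_mult H := (m H - (H == H0))%N.

Lemma sum_lowered_mult : ((\sum_(H <- A) lowered_mult H).+1 = \sum_(H <- A) m H)%N.
Proof.
rewrite (big_fsetD1 H0) //= [RHS](big_fsetD1 H0) //= /lowered_mult eqxx -addSn subn1 prednK //.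
congr (_ + _)%N; rewrite big_seq [RHS]big_seq; apply: eq_bigr => H.
by rewrite !inE => /andP[/negPf -> _]; rewrite subn0.
Qed.

Lemma deletion_logmod theta :
  logmod (enum_fset (deletion A m H0)) (@alpha_coef K V) (deletion_mult m H0) theta <->
    D lowered_mult theta.
Proof.
have E H : deletion_mult m H0 H = lowered_mult H.
  by rewrite /deletion_mult /lowered_mult; have [->|_] := eqVneq H H0; rewrite ?subn1 ?subn0.
rewrite /deletion; case: eqP => m1; split=> Dt H HA.
- have [eH|ne] := eqVneq H H0.
    by rewrite /lowered_mult eH eqxx m1; exists (der_eval theta (alpha_coef H0)); rewrite mul1r.
  by rewrite -E; apply: Dt; rewrite !inE ne.
- by rewrite E; apply: Dt; move: HA; rewrite !inE => /andP[].
- by rewrite -E; apply: Dt.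
- by rewrite E; apply: Dt.
Qed.

Lemma restrictionP X : X \in A0 -> exists U, [/\ U \in A, U != H0 & X = trace_on H0 U].
Proof. by case/imfsetP => U /=; rewrite !inE => /andP[ne UA] ->; exists U. Qed.

Lemma hyperplanes_restriction : hyperplanes A0.
Proof.
move=> X /restrictionP[U [UA ne ->]]; exact: trace_on_hyperplane (hA UA) ne.
Qed.

Lemma logder_reduce theta : D m theta -> D lowered_mult theta.
Proof.
move=> Dt H HA; apply: divides_trans (Dt H HA); apply: divides_exp_leq.
exact: leq_subr.
Qed.

Lemma logder_restore theta : D lowered_mult theta ->
  divides (al ^+ m H0) (der_eval theta (alpha_coef H0)) -> D m theta.
Proof.
move=> Dt t0 H HA; have [->//|ne] := eqVneq H H0.
by have := Dt H HA; rewrite /lowered_mult (negPf ne) subn0.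
Qed.

Lemma logder_divides theta : D m theta -> divides al (der_eval theta (alpha_coef H0)).
Proof.
move=> Dt; apply: divides_trans (Dt H0 AH0); rewrite -{1}[al]expr1.
exact: divides_exp_leq.
Qed.

(** At H_0 exactly one factor alpha_0 cancels; at the other hyperplanes alpha_0 is prime to the
    power required. *)
Lemma logder_divide eta : D m (al *: eta) -> D lowered_mult eta.
Proof.
move=> De H HA; have := De H HA; rewrite der_evalZ /lowered_mult.
have [->|ne] := eqVneq H H0.
  by rewrite -{1}(subnK m0) addn1 exprS => /(divides_cancel al0).
rewrite subn0; apply: prime_exp.
- exact/lform_prime/alpha_coef_neq0/hA.
- by rewrite lform_eq0 alpha_coef_neq0 ?hA.
- by apply: alpha_coef_coprime => //; apply: hA.
Qed.

Variables (w : 'rV[K]_n) (G : 'M[K]_(n, n0)).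
Hypotheses (wa : w *m alpha_coef H0 = 1%:M) (EG : incl_mx H0 *m G = 1%:M).
Hypothesis GE : G *m incl_mx H0 = 1%:M - alpha_coef H0 *m w.
Local Notation rho := (lsub (incl_mx H0)).
Local Notation sigma := (lsub G).

Let rho0 f : rho f = 0 <-> divides al f. Proof. exact: (rho_eq0 wa EG GE). Qed.
Let rho_al : rho al = 0. Proof. exact/rho0/divides_refl. Qed.

Lemma restrict_der_logder theta : D m theta -> D0 (restrict_der G theta).
Proof.
move=> Dt X /restrictionP[U [UA ne ->]].
have [c c0 ec] := alpha_coef_trace_on hH0 (hA UA) ne.
rewrite /restriction_mult from_trace_on // ec der_eval_Zr (der_eval_restrict wa EG GE);
  last exact: logder_divides.
have [+ _] := euler_mult_spec Am AH0 UA ne => /(_ theta).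
case; first exact/logderE.
move=> x [k ->]; rewrite lformZ exprMn -rmorphXn /=.
apply: divides_unitl; first exact/mpolyC_unit/expf_neq0.
exists (c%:MP * rho x).
rewrite rmorphD !rmorphM /= rho_al mul0r addr0 rmorphXn /= lsub_lform.
by rewrite mulrA mulrC.
Qed.

(* The multiplicity of the form of X in the polynomial B on H0 that divides
   eta(alpha) / alpha^(m(H0) - 1) modulo alpha for all eta in D(A', m'). *)
Definition excess X :=
  (\sum_(H <- localization A (from_trace X)) m H - (mstar X + m H0))%N.

Lemma sum_localization X : X \in A0 ->
  (\sum_(H <- localization A (from_trace X)) m H =
   m H0 + \sum_(U <- (A `\ H0)%fset | trace_on H0 U == X) m U)%N.
Proof.
move=> /restrictionP[U [UA ne ->]].
have -> : (\sum_(H <- localization A (from_trace (trace_on H0 U))) m H =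
   \sum_(H <- A | (H0 :&: U <= H)%VS) m H)%N.
  by rewrite /localization from_trace_on // big_fset.
rewrite big_mkcond (big_fsetD1 H0) //= capvSl -big_mkcond; congr (_ + _)%N.
rewrite [LHS]big_seq_cond [RHS]big_seq_cond; apply: eq_bigl => H.
rewrite !inE; case: (boolP (H != H0)) => //= neH; case: (boolP (H \in A)) => //= HA.
have hH := hA HA; have hU := hA UA.
apply/idP/eqP => [sub|e]; last first.
  by rewrite -from_trace_on // -e from_trace_on // capvSr.
apply/esym/hyperplane_sub; try exact: trace_on_hyperplane.
apply/subvP => x; rewrite -!memv_preim => xU; apply: (subvP sub).
by rewrite memv_cap xU andbT lfunE subvsP.
Qed.

(** The equation for e shows that the truncated subtraction in [excess] is exact. *)
Lemma excessE U : U \in A -> U != H0 ->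
  exists2 e, excess (trace_on H0 U) = e &
    (e + mstar (trace_on H0 U) + m H0 =
      \sum_(H <- localization A (from_trace (trace_on H0 U))) m H)%N /\
    forall eta, D lowered_mult eta -> exists x k, der_eval eta (alpha_coef H0) = al ^+ (m H0).-1 *
         (x * lform (alpha_coef U) ^+ e + al * k).
Proof.
move=> UA ne; have [_ [e sum F2]] := euler_mult_spec Am AH0 UA ne.
exists e; last by rewrite /restriction_mult from_trace_on.
rewrite /excess /restriction_mult from_trace_on // -sum; lia.
Qed.

(** Every hyperplane other than H_0 is counted at exactly one X, its trace, while H_0 lies in every
    A_X and is removed there by [excess]. This determines deg B. *)
Lemma sum_excess :
  (\sum_(X <- A0) excess X + \sum_(X <- A0) mstar X + m H0 = \sum_(H <- A) m H)%N.
Proof.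
rewrite -big_split /= [RHS](big_fsetD1 H0) //= addnC; congr (_ + _)%N.
transitivity (\sum_(X <- A0) \sum_(U <- (A `\ H0)%fset | trace_on H0 U == X) m U)%N.
  rewrite !big_seq; apply: eq_bigr => X XA0; have := sum_localization XA0.
  have [U [UA ne eX]] := restrictionP XA0.
  have [e ee [es _]] := excessE UA ne.
  by rewrite eX ee -es; lia.
rewrite (exchange_big_dep predT) //= big_seq [RHS]big_seq; apply: eq_bigr => U UA.
have XA0 : trace_on H0 U \in A0 by apply: in_imfset.
rewrite big_mkcond (bigD1_seq (trace_on H0 U)) ?fset_uniq //= eqxx big1 ?addn0 // => X ne.
by rewrite eq_sym (negPf ne).
Qed.

Lemma excess_divides theta g : D lowered_mult theta ->
  der_eval theta (alpha_coef H0) = al ^+ (m H0).-1 * g ->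
  divides (Qpoly (enum_fset A0) (@alpha_coef K V0) excess) (rho g).
Proof.
move=> Dt eg; apply: (Qpoly_divides (hyperplanes_arr hyperplanes_restriction)).
move=> X /restrictionP[U [UA ne ->]].
have [e -> [_ F2]] := excessE UA ne.
have [x [k exk]] := F2 theta Dt.
have -> : g = x * lform (alpha_coef U) ^+ e + al * k.
  by apply: (mulfI (expf_neq0 (m H0).-1 al0)); rewrite -eg -exk.
have [c c0 ec] := alpha_coef_trace_on hH0 (hA UA) ne.
rewrite ec lformZ exprMn -rmorphXn; apply: divides_unitl; first exact/mpolyC_unit/expf_neq0.
exists (rho x); rewrite rmorphD !rmorphM /= rho_al mul0r addr0 rmorphXn /= lsub_lform.
by rewrite mulrC.
Qed.

End Addition.

(** * The addition theorem *)

Lemma submset_extra (s t : seq nat) : size t = (size s).+1 ->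
  (seq_mset s `<=` seq_mset t)%mset -> exists r, perm_eq t (r :: s).
Proof.
move=> st /msubsetP sub.
have /count_subseqP[s' ss' ps'] : forall x, (count_mem x s <= count_mem x t)%N.
  by move=> x; have := sub x; rewrite !mset_seqE.
have [u pu] := perm_to_subseq ss'.
have su : size u = 1%N.
  have := perm_size pu; rewrite size_cat st -(perm_size ps') => /eqP.
  by rewrite -addn1 eqn_add2l => /eqP.
case: u su pu => [|r [|]] // _ pu; exists r.
by rewrite (perm_trans pu) // -cat1s perm_catC perm_cat2l perm_sym.
Qed.

(** Here e = deg B, t = |m^*|, mu = m(H_0), T = |m|, and x is the [msize] of the cofactor of B. As
    [msize] is the degree plus one, the bound says that the cofactor is constant. *)
Lemma degree_count x d r e t mu T : (e.+1 + x).-1 = (d - 1 * mu.-1).+1 ->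
  (1 * mu.-1 <= d)%N -> (d <= r)%N -> (e + t + mu = T)%N -> (r + 1 + t = T)%N ->
  (0 < mu)%N -> (x <= 1)%N.
Proof. lia. Qed.

(** Rewriting a combination h of the rows of M in terms of row j - F j row i0 leaves h_i0 + sum h_j
    F_j on row i0; divisibility by f lets f times row i0 absorb it. *)
Lemma basis_exchange (R : idomainType) r (D D' : 'rV[R]_r -> Prop) (M : 'M[R]_r)
    (i0 : 'I_r) (F : 'I_r -> R) f : f != 0 -> basis_mx D M ->
  (forall theta, D' theta -> D theta) -> D' (f *: row i0 M) ->
  (forall j, j != i0 -> D' (row j M - F j *: row i0 M)) ->
  (forall h : 'rV_r, D' (h *m M) ->
     divides f (h 0 i0 + \sum_(j | j != i0) h 0 j * F j)) ->
  exists M' : 'M[R]_r, basis_mx D' M'.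
Proof.
move=> f0 [DM spM frM] D'D Df DF div.
pose M' : 'M[R]_r := \matrix_j if j == i0 then f *: row i0 M else row j M - F j *: row i0 M.
have M'E (h : 'rV_r) : h *m M' = (\row_j if j == i0 then
    f * h 0 i0 - \sum_(j | j != i0) h 0 j * F j else h 0 j) *m M.
  rewrite !mulmx_sum_row (bigD1 i0) //= [RHS](bigD1 i0) //= rowK eqxx mxE eqxx.
  rewrite scalerBl scalerA [h 0 i0 * f]mulrC -[RHS]addrA; congr (_ + _).
  rewrite scaler_suml addrC -sumrB; apply: eq_bigr => j ne.
  by rewrite rowK mxE (negPf ne) scalerBr scalerA.
exists M'; split.
- by move=> j; rewrite rowK; case: eqVneq => [_|ne]; [exact: Df | exact: DF].
- move=> theta D't; have [h eh] := spM _ (D'D _ D't).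
  rewrite eh in D't; have [t et] := div h D't.
  exists (\row_j if j == i0 then t else h 0 j); rewrite eh M'E; congr (_ *m M).
  apply/rowP => j; rewrite !mxE eqxx; case: eqVneq => [->|] //.
  rewrite -et [X in _ - X](eq_bigr (fun j => h 0 j * F j)) ?addrK // => k ne.
  by rewrite mxE (negPf ne).
- move=> h; rewrite M'E => /frM/rowP h0.
  have hj j : j != i0 -> h 0 j = 0.
    by move=> ne; have := h0 j; rewrite !mxE (negPf ne).
  apply/rowP => j; rewrite mxE; have [->|/hj//] := eqVneq j i0.
  have := h0 i0; rewrite !mxE eqxx big1 => [|k /hj ->]; last by rewrite mul0r.
  by rewrite subr0 => /eqP; rewrite mulf_eq0 (negPf f0) => /eqP.
Qed.

Theorem theorem0p7 (K : fieldType) (V : vectType K)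
    (A : {fset {vspace V}}) (m : {vspace V} -> nat) (H0 : {vspace V})
    (dimV_ge2 : (2 <= \dim (fullv : {vspace V}))%N)
    (Am_multiarrangement : is_multiarrangement A m)
    (H0_in_A : H0 \in A)
    (deletion_free : is_free (deletion A m H0) (deletion_mult m H0))
    (restriction_free : is_free (restriction A H0) (restriction_mult A m (H0 := H0)))
    (exp_sub :
      (exponents (restriction A H0) (restriction_mult A m (H0 := H0))
        `<=` exponents (deletion A m H0) (deletion_mult m H0))%mset) :
  is_free A m.
Proof.
have hA : hyperplanes A by move=> H /Am_multiarrangement[].
have hH0 := hA _ H0_in_A.
have m0 : (0 < m H0)%N by have [] := Am_multiarrangement _ H0_in_A.
have hA0 := hyperplanes_restriction Am_multiarrangement H0_in_A.
have hA' : hyperplanes (deletion A m H0).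
  by move=> H; rewrite /deletion; case: ifP => _; rewrite ?inE; [case/andP => _ /hA | move/hA].
have arrA := hyperplanes_arr hA; have arrA0 := hyperplanes_arr hA0.
have [M [d [bM' Md eM]]] := exponents_spec hA' deletion_free.
have {bM'} bM := basis_mx_ext (deletion_logmod A m H0) bM'.
have [N [d0 [bN Nd eN]]] := exponents_spec hA0 restriction_free.
have nE := dim_restriction hH0.
rewrite eM eN in exp_sub.
have [|r pr] := submset_extra _ exp_sub; first by rewrite 2!size_map !size_enum_ord nE.
have [w [G [wa EG GE]]] := exists_retraction hH0.
set al := lform (alpha_coef H0).
have al0 : al != 0 by rewrite lform_eq0 alpha_coef_neq0.
have sumM := saito_degree arrA bM Md.
have sumN := saito_degree arrA0 bN Nd.
have sumE := sum_excess Am_multiarrangement H0_in_A.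
(* Saito's degree sums give r = |m'| - |m^*|, and |m'| = |m| - 1. *)
have rE : (r + 1 + \sum_(X <- restriction A H0) restriction_mult A m (H0 := H0) X =
    \sum_(H <- A) m H)%N.
  have : (\sum_i d i = r + \sum_i d0 i)%N.
    have /= := perm_big (op := addn) (x := 0%N) (P := predT) (F := id) _ pr.
    by rewrite big_cons 2!big_map !big_enum.
  by rewrite sumN sumM -(sum_lowered_mult Am_multiarrangement H0_in_A) => ->; rewrite addnAC addn1.
have [i0 di0 Di0] : exists2 i, (d i <= r)%N & ~ logmod (enum_fset A) (@alpha_coef K V) m (row i M).
  apply: NNPP => no.
  have DM i : (d i <= r)%N -> logmod (enum_fset A) (@alpha_coef K V) m (row i M).
    by move=> di; apply: NNPP => nD; apply: no; exists i.
  (* The equality of multisets becomes a matching of the d i: k i = 0 stands for r and k i = j + 1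
     for d0 j. *)
  have /(perm_iotaP 0%N)[Is pIs eIs] := pr.
  have sIs : size Is = \dim (fullv : {vspace V}).
    by rewrite (perm_size pIs) size_iota /= size_map size_enum_ord.
  pose k (i : 'I_(\dim (fullv : {vspace V}))) := nth 0%N Is i.
  have dk i : d i =
      nth 0%N (r :: [seq d0 j | j <- enum 'I_(\dim (fullv : {vspace subvs_of H0}))]) (k i).
    have := congr1 (fun t => nth 0%N t i) eIs.
    by rewrite /= (nth_map i) ?size_enum_ord // nth_ord_enum (nth_map 0%N) ?sIs.
  have kn i : (k i <= \dim (fullv : {vspace subvs_of H0}))%N.
    have : k i \in Is by rewrite mem_nth ?sIs.
    by rewrite (perm_mem pIs) mem_iota /= add0n size_map size_enum_ord ltnS.
  have kinj : injective k.
    move=> i i' /eqP; rewrite nth_uniq ?sIs // => [/eqP/val_inj //|].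
    by rewrite (perm_uniq pIs) iota_uniq.
  have /fin_all_exists[C CP] : forall i, exists f : 'rV_(\dim (fullv : {vspace subvs_of H0})),
      (d i <= r)%N -> restrict_der G (row i M) = f *m N /\ forall j, (d i < d0 j)%N -> f 0 j = 0.
    (* Rows of degree above r get the dummy 0, since the relation found below does not involve
       them. *)
    move=> i; have [di|ndi] := leqP (d i) r; last by exists 0.
    have := restrict_der_logder Am_multiarrangement H0_in_A wa EG GE (DM i di).
    have rh : forall j, restrict_der G (row i M) 0 j \is (d i).-homog.
      by apply: restrict_der_homog => j; rewrite mxE.
    move=> /(homog_basis_coords bN Nd)/(_ rh)[f f1 f2].
    by exists f => _; split.
  (* A row of degree above r is matched with some d0 j above r, where the restrictions of the rows
     of degree at most r have coefficient zero. *)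
  have [||i|i i' j di|v v0 [vP vC]] := @dep_matrix_kernel _ _ _ (\matrix_i C i)
     (fun i => (d i <= r)%N) k.
  - by rewrite -nE.
  - exact: kinj.
  - rewrite kn andbT lt0n => ndi; apply: contra ndi => /eqP k0.
    by rewrite dk k0.
  - rewrite -ltnNge => di' ki'; rewrite mxE; have [_] := CP i di; apply.
    apply: leq_ltn_trans di _; apply: leq_trans di' _.
    by rewrite dk ki' /= (nth_map j) ?size_enum_ord // nth_ord_enum.
  (* The relation over S'' is lifted to S by pulling its coefficients back along the projection onto
     H_0. *)
  pose theta := map_mx (lsub G) v *m M.
  have rt : restrict_der G theta = 0.
    rewrite restrict_der_mul; have -> : map_mx (lsub (incl_mx H0)) (map_mx (lsub G) v) = v.
      by apply/rowP => i; rewrite !mxE (rho_sigma EG).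
    have -> : v *m restrict_der G M = v *m (\matrix_i C i) *m N.
      rewrite -mulmxA !mulmx_sum_row; apply: eq_bigr => i _.
      rewrite row_mul rowK -restrict_der_row.
      have [di|ndi] := boolP (d i <= r)%N; first by have [->] := CP i di.
      by rewrite vP // !scale0r.
    have -> : v *m (\matrix_i C i) = 0 by apply/rowP => j; rewrite !mxE.
    by rewrite mul0mx.
  have Dt : logmod (enum_fset A) (@alpha_coef K V) m theta.
    move=> H HA; rewrite der_eval_mul; apply: divides_sum => i _.
    have [di|ndi] := boolP (d i <= r)%N; first by apply: divides_mull; apply: DM.
    by rewrite mxE vP // rmorph0 mul0r; apply: divides0.
  have [eta eeta] := restrict_der_eq0 wa EG GE (logder_divides Am_multiarrangement H0_in_A Dt) rt.
  rewrite eeta in Dt; have Deta := logder_divide Am_multiarrangement H0_in_A Dt.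
  have [_ spM frM] := bM; have [g eg] := spM _ Deta.
  (* Independence of the rows makes the lifted coefficients equal to al g, so they vanish on H_0,
     where they restrict to v. *)
  have /frM/rowP z : (map_mx (lsub G) v - al *: g) *m M = 0.
    by rewrite mulmxBl -/theta eeta eg -scalemxAl subrr.
  case/eqP: v0; apply/rowP => i; rewrite mxE -[LHS](rho_sigma EG).
  have /eqP := z i; rewrite !mxE subr_eq0 => /eqP ->.
  by apply/(rho_eq0 wa EG GE)/divides_mulr/divides_refl.
have [DM spM frM] := bM.
have /fin_all_exists[g eg] : forall j,
    exists g, der_eval (row j M) (alpha_coef H0) = al ^+ (m H0).-1 * g.
  by move=> j; have := DM j H0 H0_in_A; rewrite /lowered_mult eqxx subn1.
have rho0 := rho_eq0 wa EG GE.
pose B := Qpoly (enum_fset (restriction A H0))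
  (@alpha_coef K (subvs_of H0)) (excess A m (H0 := H0)).
have /fin_all_exists[h eh] : forall j, exists h, lsub (incl_mx H0) (g j) = B * h.
  by move=> j; apply: (excess_divides Am_multiarrangement H0_in_A wa EG GE (DM j) (eg j)).
have rg0 : lsub (incl_mx H0) (g i0) != 0.
  apply/eqP => /rho0[g' eg']; apply: Di0.
  apply: (logder_restore (DM i0)); exists g'.
  by rewrite eg eg' mulrA -exprSr prednK.
have [c c0 ehi0] : exists2 c, c != 0 & h i0 = c%:MP.
  have g0 : g i0 != 0 by apply: contraNneq rg0 => ->; rewrite rmorph0.
  have hi0 : h i0 != 0 by apply: contraNneq rg0 => z; rewrite eh z mulr0.
  have alk : al ^+ (m H0).-1 \is (1 * (m H0).-1).-homog by apply/dhomogMn/lform_homog.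
  have [||kd gd] := homog_factor (d := d i0) _ g0 alk.
  - exact: expf_neq0.
  - rewrite -eg /der_eval mxE; apply: rpred_sum => i _.
    by rewrite !mxE mulrC mul_mpolyC; apply/rpredZ/Md.
  have B0 : B != 0 by apply: Qpoly_neq0.
  have := dhomog_size rg0 (lsub_homog (incl_mx H0) gd).
  rewrite eh msizeM // (dhomog_size B0 (Qpoly_homog _ _ _)) => sz.
  have hC : h i0 = ((h i0)@_0)%:MP by apply: msize1_polyC; apply: degree_count sz kd di0 sumE rE m0.
  by exists (h i0)@_0 => //; rewrite -(mpolyC_eq0 (\dim (fullv : {vspace subvs_of H0}))) -hC.
(* As rho(g i0) = c B, the quotient of rho(g j) by rho(g i0) is h j / c; F j lifts it to S. *)
pose F j := lsub G (c^-1%:MP * h j).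
have rhoF j : lsub (incl_mx H0) (g j) = lsub (incl_mx H0) (F j) * lsub (incl_mx H0) (g i0).
  rewrite (rho_sigma EG) !eh ehi0 mulrCA; congr (_ * _).
  by rewrite mulrAC -mpolyCM mulVf // mpolyC1 mul1r.
apply/(is_freeP m hA).
apply: (basis_exchange (i0 := i0) (F := F) al0 bM).
- by move=> theta; apply: logder_reduce.
- apply: (logder_restore (logmodZ al (DM i0))).
  by rewrite der_evalZ eg mulrA -exprS prednK //; apply/divides_mulr/divides_refl.
- move=> j ne; apply: logder_restore.
    by apply: logmodD; rewrite -?scaleNr; [apply: DM | apply/logmodZ/DM].
  have [x ex] : divides al (g j - F j * g i0).
    by apply/rho0; rewrite rmorphB rmorphM /= rhoF subrr.
  exists x; rewrite der_evalD der_evalN der_evalZ !eg mulrCA -mulrBr ex.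
  by rewrite mulrA -exprSr prednK.
move=> f Df.
have : divides al (\sum_j f 0 j * g j).
  have := Df H0 H0_in_A; rewrite der_eval_mul.
  rewrite (eq_bigr (fun j => al ^+ (m H0).-1 * (f 0 j * g j))) => [|j _]; last first.
    by rewrite eg mulrCA.
  rewrite -mulr_sumr -{1}(prednK m0) exprSr; apply: divides_cancel.
  exact: expf_neq0.
(* On H_0 the sum of the f_j g_j is the coefficient to be tested times rho(g i0), which is nonzero
   and cancels. *)
move=> /rho0 sum0; apply/rho0; apply: (mulIf rg0); rewrite mul0r -[RHS]sum0.
rewrite rmorphD rmorph_sum /= mulrDl [in RHS]rmorph_sum /= [RHS](bigD1 i0) //= rmorphM.
congr (_ + _); by rewrite mulr_suml; apply: eq_bigr => j _; rewrite !rmorphM /= (rhoF j) mulrA.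
Qed.
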